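(* Let $\{(N_k,B_k)\}_{k=1}^\infty$ be a sequence such that, for all $k\in\mathbb{N}$, $B_k=\{0,1,2,\dots,M_k-2,\;n_kM_k-1\}$, where $N_k\ge M_k\ge3$ and $n_k\ge1$ are integers. Suppose that $\sum_{k=1}^\infty\frac1{M_k}<\infty$ and that $\gcd(n_kM_k-1,\,M_k-2)=1$ for all $k$ such that $M_k$ is even and $M_k\ge5$. Then the infinite convolution $\mu$ of $\{(N_k,B_k)\}_{k=1}^\infty$ is a spectral measure if and only if $M_k\mid N_k$ for all $k\ge2$.
   Context: $\mathbb{N}=\{1,2,3,\dots\}$. For a finite nonempty set $A\subset\mathbb{R}$, $\delta_A=\frac1{\#A}\sum_{a\in A}\delta_a$ with $\delta_a$ the Dirac measure at $a$. The infinite convolution $\mu=\delta_{N_1^{-1}B_1}*\delta_{(N_1N_2)^{-1}B_2}*\cdots$ is the weak limit, as $n\to\infty$, of $\delta_{N_1^{-1}B_1}*\cdots*\delta_{(N_1\cdots N_n)^{-1}B_n}$, a Borel probability measure on $\mathbb{R}$ (the limit exists under the hypotheses here). A Borel probability measure $\mu$ on $\mathbb{R}$ is a spectral measure if there is a countable $\Lambda\subseteq\mathbb{R}$ such that $\{e^{-2\pi i\lambda x}:\lambda\in\Lambda\}$ is an orthonormal basis of $L^2(\mu)$. *)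

(* Defs.v *)
From HB Require Import structures.
From mathcomp Require Import all_boot all_order all_algebra finmap.
From mathcomp Require Import all_classical all_reals all_analysis.
From mathcomp.real_closed Require Import complex.

Set Implicit Arguments.
Unset Strict Implicit.
Unset Printing Implicit Defensive.

Import Order.TTheory GRing.Theory Num.Theory.
Import numFieldNormedType.Exports.

Local Open Scope classical_set_scope.
Local Open Scope ring_scope.

Section discrete_uniform.
Context {R : realType}.
Local Notation RR := (measurableTypeR R).

(* A is meant to be nonempty: delta_fset fset0 is the zero measure. *)
Definition delta_fset (A : {fset R}) (U : set RR) : \bar R :=
  ((#|` A|%:R^-1)%:E * \sum_(a <- A) \d_(a : RR) U)%E.

Let delta_fset0 A : delta_fset A set0 = 0%E.
Proof. by rewrite /delta_fset big1 ?mule0// => a _; rewrite measure0. Qed.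

Let delta_fset_ge0 A U : (0 <= delta_fset A U)%E.
Proof.
by rewrite /delta_fset mule_ge0 ?lee_fin ?invr_ge0//; apply: sume_ge0 => a _.
Qed.

Let delta_fset_sigma_additive A : semi_sigma_additive (delta_fset A).
Proof.
have rge0 : 0 <= (#|` A|%:R^-1 : R) by rewrite invr_ge0.
have -> : delta_fset A = mscale (NngNum rge0)
    (msum (fun i => \d_((A : seq R)`_i : RR)) #|` A|).
  apply/funext => U; rewrite /delta_fset /mscale /msum /=.
  by rewrite (big_nth 0) big_mkord.
exact: measure_semi_sigma_additive.
Qed.

HB.instance Definition _ A := isMeasure.Build _ _ _ (delta_fset A)
  (delta_fset0 A) (delta_fset_ge0 A) (@delta_fset_sigma_additive A).

Let delta_fset_fin A : fin_num_fun (delta_fset A).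
Proof.
move=> U mU; rewrite /delta_fset fin_numM//.
by apply/sum_fin_numP => a _ _; exact: fin_num_measure.
Qed.

HB.instance Definition _ A :=
  @Measure_isFinite.Build _ _ _ (delta_fset A) (@delta_fset_fin A).

End discrete_uniform.

Section convolution.
Context {R : realType}.
Local Notation RR := (measurableTypeR R).

Definition convolution (mu nu : {finite_measure set RR -> \bar R}) :
    set RR -> \bar R :=
  pushforward (mu \x nu)%E (fun x : RR * RR => (x.1 + x.2 : RR)).

Variables mu nu : {finite_measure set RR -> \bar R}.

Let add2 (x : RR * RR) : RR := x.1 + x.2.

Let measurable_add2 : measurable_fun [set: RR * RR] add2.
Proof. exact: (measurable_realfun.measurable_funD
  measurable_fst measurable_snd). Qed.

#[local] HB.instance Definition _ :=
  @isMeasurableFun.Build _ _ _ _ add2 measurable_add2.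

Let convolution0 : convolution mu nu set0 = 0%E.
Proof. exact: (measure0 (pushforward (mu \x nu)%E add2)). Qed.

Let convolution_ge0 U : (0 <= convolution mu nu U)%E.
Proof. exact: (measure_ge0 (pushforward (mu \x nu)%E add2)). Qed.

Let convolution_sigma_additive : semi_sigma_additive (convolution mu nu).
Proof.
exact: (@measure_semi_sigma_additive _ _ _ (pushforward (mu \x nu)%E add2)).
Qed.

HB.instance Definition _ := isMeasure.Build _ _ _ (convolution mu nu)
  convolution0 convolution_ge0 convolution_sigma_additive.

Let convolution_fin : fin_num_fun (convolution mu nu).
Proof.
apply: lty_fin_num_fun => /=.
rewrite /convolution /pushforward preimage_setT -setXTT product_measure1E//.
by rewrite lte_mul_pinfty// ?fin_num_measure// ltey_eq fin_num_measure.
Qed.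

HB.instance Definition _ :=
  @Measure_isFinite.Build _ _ _ (convolution mu nu) convolution_fin.

End convolution.

Section infinite_convolution.
Context {R : realType}.
Local Notation RR := (measurableTypeR R).

Definition weak_cvg (mu_ : nat -> {finite_measure set RR -> \bar R})
    (mu : {finite_measure set RR -> \bar R}) : Prop :=
  forall f : R -> R, continuous f -> (exists K : R, forall x, `|f x| <= K) ->
    \int[mu_ n]_x f x @[n --> \oo] --> \int[mu]_x f x.

(* The set (N_1 ... N_k)^-1 B_k; sequences are indexed from 1, so the values
   of N and B at 0 are never used. *)
Definition scaled_digits (N : nat -> nat) (B : nat -> {fset nat}) (k : nat) :
    {fset R} :=
  [fset ((\prod_(1 <= j < k.+1) N j)%:R^-1 * b%:R)%R | b in B k]%fset.

(* The empty convolution (n = 0) is the Dirac mass at 0, the neutral element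
   of convolution. *)
Fixpoint finite_convolution (N : nat -> nat) (B : nat -> {fset nat}) (n : nat) :
    {finite_measure set RR -> \bar R} :=
  if n is m.+1 then
    convolution (finite_convolution N B m) (delta_fset (scaled_digits N B m.+1))
  else \d_(0 : RR).

Definition is_infinite_convolution (N : nat -> nat) (B : nat -> {fset nat})
    (mu : probability RR R) : Prop :=
  weak_cvg (finite_convolution N B) mu.

End infinite_convolution.

Definition digit_set (M n : nat) : {fset nat} :=
  ([fset i in iota 0 (M - 1)] `|` [fset (n * M - 1)%N])%fset.

Section spectral.
Context {R : realType}.
Local Notation RR := (measurableTypeR R).
Local Notation C := (R[i]).
Variable mu : {measure set RR -> \bar R}.

Definition cLnorm2 (f : RR -> C) : \bar R :=
  ('N[mu]_2%:E[EFin \o (@ComplexField.Normc.normc R \o f)])%E.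

Definition in_cL2 (f : RR -> C) : Prop :=
  [/\ measurable_fun setT (fun x => complex.Re (f x)),
      measurable_fun setT (fun x => complex.Im (f x)) &
      (cLnorm2 f < +oo)%E].

Definition cintegral (f : RR -> C) : C :=
  Complex (\int[mu]_x complex.Re (f x)) (\int[mu]_x complex.Im (f x)).

Definition cinner (f g : RR -> C) : C := cintegral (fun x => f x * conjc (g x)).

Definition orthonormal_family (Lam : set R) (e : R -> RR -> C) : Prop :=
  (forall l, Lam l -> in_cL2 (e l)) /\
  (forall l l', Lam l -> Lam l' -> cinner (e l) (e l') = (l == l')%:R).

(* The finite linear combinations of the family are dense in L^2(mu). *)
Definition total_family (Lam : set R) (e : R -> RR -> C) : Prop :=
  forall f, in_cL2 f -> forall eps : R, 0 < eps ->
    exists (F : {fset R}) (c : R -> C), [set` F] `<=` Lam /\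
      (cLnorm2 (fun x => f x - \sum_(l <- F) c l * e l x)%R < eps%:E)%E.

Definition orthonormal_basis (Lam : set R) (e : R -> RR -> C) : Prop :=
  orthonormal_family Lam e /\ total_family Lam e.

End spectral.

(* x |-> e^{-2 i pi l x} *)
Definition expo {R : realType} (l : R) (x : measurableTypeR R) : R[i] :=
  Complex (cos (- (2 * pi * l * x))) (sin (- (2 * pi * l * x))).

Definition spectral_measure {R : realType}
    (mu : probability (measurableTypeR R) R) : Prop :=
  exists Lam : set R, countable Lam /\ orthonormal_basis mu Lam expo.

(* Main.v *)
Require Import Defs.
From HB Require Import structures.
From mathcomp Require Import all_boot all_order all_algebra finmap.
From mathcomp Require Import all_classical all_reals all_analysis.
From mathcomp Require Import measurable_realfun.
From mathcomp.real_closed Require Import complex.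
From mathcomp Require Import ring lra zify.

(** Let P_k = N_1 ... N_k. The Fourier transform of mu is the product over k of
    the masks m_k (xi / P_k), where m_k is the transform of the uniform measure on
    the k-th digits. The digits of level k represent each residue modulo M_k once,
    so sum_(h < M_k) |m_k (x - h / M_k)|^2 = 1 (sum_wmask), and the gcd condition
    ensures that m_k vanishes only in (1/M_k) Z (mask_eq0). A family of
    exponentials is an orthonormal basis of L^2(mu) if and only if it is orthogonal
    and satisfies Parseval's identity for all exponentials (spectral_parseval);
    this rests on the density of trigonometric polynomials (trig_dense), obtained
    by producing indicators of rays from sine waves with the smoothstep polynomial.

    Necessity. Let L be a spectrum, and consider one level k. In each coset of the
    lattice (P_k / M_k) Z, which contains the zeros of the k-th mask, select one
    class modulo P_k Z. Differences of selected points of L are not zeros of this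
    mask, so the selected points are orthogonal for the product of the other levels
    and Bessel's inequality bounds their sum by 1. On the other hand Parseval's
    identity for L writes 1 as a sum over cosets of averages over classes, with the
    weights of sum_wmask. Hence all classes of a coset have the same sum and every
    selection satisfies Parseval's identity for the other levels
    (selection_full_sum, level_step). If M_j does not divide N_j for some j = k + 1,
    select at level k so as to keep 0 and drop the class of P_j / M_j, then at
    level j so that nothing remains in the coset of 0: then 0 is orthogonal to a
    complete family, a contradiction (spectrum_divides). Bessel's inequality is
    proved for positive definite functions, so that levels may be removed without
    constructing the corresponding measures (bessel_removed).

    Sufficiency. If M_k divides N_k for k >= 2, the sums of multiples of
    P_i / M_i by centred residues modulo M_i, for i <= k, form a spectrum of the
    k-th finite convolution (sum_level_spectrum). Their union L is orthogonal, and
    Parseval's identity for L follows from those of the finite convolutions by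
    dominated convergence (spectrum_parseval), provided that the tail of the
    product is bounded below on these frequencies. This is fourier_fin_lower: the
    frequencies of level m are at most about P_m / 2, the mask of level m + 1 is
    bounded below there because M_(m+1) <= N_(m+1), and the defects of the later
    masks are O (1 / M_i + 1 / M_(i-1)), summable by hypothesis. *)

Set Implicit Arguments.
Unset Strict Implicit.
Unset Printing Implicit Defensive.

Import Order.TTheory GRing.Theory Num.Theory.
Import numFieldNormedType.Exports.
Import HBNNSimple.

Local Open Scope classical_set_scope.
Local Open Scope ring_scope.

(** * The additive character and squared moduli *)

(* Keeps /= from unfolding e and mask under a conjugation. *)
Arguments conjc : simpl never.

(** The additive character exp (2 i pi t), of period 1. *)
Definition e {R : realType} (t : R) : R[i] :=
  Complex (cos (2 * pi * t)) (sin (2 * pi * t)).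
Arguments e : simpl never.

(** The squared modulus, with values in R: the norm of R[i] has values in R[i],
    where it can be neither integrated nor compared with real bounds. *)
Definition nsq {R : realType} (z : R[i]) : R :=
  complex.Re z ^+ 2 + complex.Im z ^+ 2.
Arguments nsq : simpl never.

Section Exponentials.
Context {R : realType}.
Local Notation C := R[i].
Implicit Types (t x y : R) (z w : C).

Lemma nsqM z w : nsq (z * w) = nsq z * nsq w.
Proof. by case: z w => [a b] [c d]; rewrite /nsq /=; ring. Qed.

Lemma nsq_ge0 z : 0 <= nsq z.
Proof. by rewrite addr_ge0 ?sqr_ge0. Qed.

Lemma nsq_eq0 z : (nsq z == 0) = (z == 0).
Proof.
case: z => [a b]; rewrite /nsq /= eq_complex /=.
by rewrite paddr_eq0 ?sqr_ge0// !sqrf_eq0.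
Qed.

Lemma nsq0 : nsq 0 = 0 :> R. Proof. by rewrite /nsq /=; ring. Qed.

Lemma nsq1 : nsq 1 = 1 :> R. Proof. by rewrite /nsq /=; ring. Qed.

Lemma nsqE z : (nsq z)%:C%C = z * conjc z.
Proof. by case: z => [a b]; rewrite /nsq /=; simpc; congr Complex; ring. Qed.

Lemma nsq_prod (I : Type) (s : seq I) (P : pred I) (F : I -> C) :
  nsq (\prod_(i <- s | P i) F i) = \prod_(i <- s | P i) nsq (F i).
Proof. exact: (big_morph nsq nsqM nsq1). Qed.

Lemma ReD z w : complex.Re (z + w) = complex.Re z + complex.Re w.
Proof. by case: z w => [a b] [c d]. Qed.

Lemma ImD z w : complex.Im (z + w) = complex.Im z + complex.Im w.
Proof. by case: z w => [a b] [c d]. Qed.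

Lemma Re_sum (I : Type) (s : seq I) (P : pred I) (F : I -> C) :
  complex.Re (\sum_(i <- s | P i) F i) = \sum_(i <- s | P i) complex.Re (F i).
Proof. exact: (big_morph _ ReD). Qed.

Lemma Im_sum (I : Type) (s : seq I) (P : pred I) (F : I -> C) :
  complex.Im (\sum_(i <- s | P i) F i) = \sum_(i <- s | P i) complex.Im (F i).
Proof. exact: (big_morph _ ImD). Qed.

Lemma ReMl (a : R) z : complex.Re (a%:C%C * z) = a * complex.Re z.
Proof. by case: z => [c d] /=; rewrite mul0r subr0. Qed.

Lemma ImMl (a : R) z : complex.Im (a%:C%C * z) = a * complex.Im z.
Proof. by case: z => [c d] /=; rewrite mul0r addr0. Qed.

Lemma natVC (n : nat) : (n%:R^-1 : C) = (n%:R^-1)%:C%C.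
Proof. by rewrite fmorphV/= rmorph_nat. Qed.

Lemma conjcM z w : conjc (z * w) = conjc z * conjc w.
Proof. exact: rmorphM. Qed.

Lemma conjcN z : conjc (- z) = - conjc z.
Proof. exact: raddfN. Qed.

Lemma conjc_sum (I : Type) (s : seq I) (P : pred I) (F : I -> C) :
  conjc (\sum_(i <- s | P i) F i) = \sum_(i <- s | P i) conjc (F i).
Proof. exact: raddf_sum. Qed.

Lemma conjc_prod (I : Type) (s : seq I) (P : pred I) (F : I -> C) :
  conjc (\prod_(i <- s | P i) F i) = \prod_(i <- s | P i) conjc (F i).
Proof. exact: rmorph_prod. Qed.

Lemma e0 : e 0 = 1 :> C.
Proof. by rewrite /e mulr0 cos0 sin0. Qed.

Lemma eD t u : e (t + u) = e t * e u.
Proof.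
rewrite /e !mulrDr cosD sinD; simpc; congr Complex; ring.
Qed.

Lemma e_conj t : conjc (e t) = e (- t).
Proof. by rewrite /e /= mulrN cosN sinN. Qed.

Lemma nsq_e t : nsq (e t) = 1.
Proof. by rewrite /nsq /e /= cos2Dsin2. Qed.

Lemma e_neq0 t : e t != 0.
Proof. by rewrite -nsq_eq0 nsq_e oner_eq0. Qed.

Lemma eN t : e (- t) = (e t)^-1.
Proof.
by apply: (mulfI (e_neq0 t)); rewrite -eD subrr e0 divff// e_neq0.
Qed.

Lemma e_natl (n : nat) t : e (n%:R * t) = e t ^+ n.
Proof.
elim: n => [|n IH]; first by rewrite mul0r e0 expr0.
by rewrite -natr1 mulrDl mul1r eD IH exprSr.
Qed.

Lemma e1 : e 1 = 1 :> C.
Proof.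
rewrite /e mulr1 (_ : 2 * pi = pi *+ 2); last by rewrite mulr_natl.
by rewrite cos2pi sin2pi.
Qed.

Lemma e_int (m : int) : e m%:~R = 1 :> C.
Proof.
have en (n : nat) : e n%:R = 1 :> C by rewrite -[n%:R]mulr1 e_natl e1 expr1n.
case: m => n; first exact: en.
by rewrite NegzE mulrNz eN en invr1.
Qed.

Lemma eDint t (m : int) : e (t + m%:~R) = e t.
Proof. by rewrite eD e_int mulr1. Qed.

(** If t had a nonzero fractional part r, then sin (pi r) would be positive,
    against cos (2 pi r) = 1 - 2 sin (pi r)^2. *)
Lemma e_eq1 t : e t = 1 -> t \is a Num.int.
Proof.
move=> et; have := floor_le t; have := floorD1_gt t.
set m := Num.floor t => tlt tge.
have er : e (t - m%:~R) = 1 by rewrite eD et -mulrNz e_int mul1r.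
have [r0|r0] := eqVneq (t - m%:~R) 0.
  by rewrite -(subrK m%:~R t) r0 add0r intr_int.
exfalso.
have rgt : 0 < t - m%:~R by rewrite lt_def r0 subr_ge0.
have rlt : t - m%:~R < 1.
  by rewrite ltrBlDl; move: tlt; rewrite intrD.
have : 0 < sin (pi * (t - m%:~R)).
  by apply: sin_gt0_pi; rewrite mulr_gt0 ?pi_gt0//= gtr_pMr ?pi_gt0.
have : cos (2 * pi * (t - m%:~R)) = 1 by case: er.
rewrite -mulrA mulr_natl cos_mulr2n cos2sin2.
move: (sin _) => s h s0; have : s ^+ 2 = 0.
  by move: h; rewrite -mulr_natl; lra.
by move/eqP; rewrite sqrf_eq0 => /eqP s00; rewrite s00 ltxx in s0.
Qed.

(** Points of the unit circle at the same distance from 1 have the same real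
    part, so they are equal or conjugate. *)
Lemma unit_dist_eq z w : nsq z = 1 -> nsq w = 1 ->
  nsq (z - 1) = nsq (w - 1) -> z = w \/ z * w = 1.
Proof.
case: z w => [a b] [c d]; rewrite /nsq /= => h1 h2 h3.
have ac : a = c.
  have e1 : a * (2 * 1) = c * (2 * 1) by move: h3; rewrite oppr0 !addr0; lra.
  by apply: (@mulIf _ (2 * 1)) => //; rewrite mulr1 pnatr_eq0.
subst c; have /eqP : (b - d) * (b + d) = 0 by lra.
rewrite mulf_eq0 => /orP[/eqP h|/eqP h].
- left; have -> : b = d by lra.
  by [].
- right; have -> : d = - b by lra.
  by simpc; rewrite -!expr2 h1; congr Complex; ring.
Qed.

End Exponentials.

(** * Masks of the digit sets *)

(** An enumeration of the digit set by 0, ..., M - 1 for which the i-th digit is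
    congruent to i modulo M. *)
Definition digit (M n i : nat) : nat := if (i < M.-1)%N then i else (n * M - 1)%N.

(** The Fourier transform of the uniform probability on the digits. *)
Definition mask {R : realType} (M n : nat) (x : R) : R[i] :=
  M%:R^-1 * \sum_(i < M) e (- ((digit M n i)%:R * x)).
Arguments mask : simpl never.

Section Mask.
Context {R : realType}.
Local Notation C := R[i].
Implicit Types (x y : R).

Definition wmask M n x : R := nsq (mask M n x).

Lemma wmask_ge0 M n x : 0 <= wmask M n x. Proof. exact: nsq_ge0. Qed.

Lemma mask0 M n : (0 < M)%N -> mask M n 0 = 1 :> C.
Proof.
move=> M0; rewrite /mask (eq_bigr (fun=> 1)); last first.
  by move=> i _; rewrite mulr0 oppr0 e0.
by rewrite sumr_const card_ord mulVf// pnatr_eq0 -lt0n.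
Qed.

Lemma mask_Dint M n x (m : int) : mask M n (x + m%:~R) = mask M n x.
Proof.
congr (_ * _); apply: eq_bigr => i _; rewrite mulrDr opprD.
by rewrite -[(digit _ _ _)%:R]/((digit M n i)%:Z%:~R) -intrM -mulrNz eDint.
Qed.

Lemma mask_int M n x : (0 < M)%N -> x \is a Num.int -> mask M n x = 1.
Proof.
by move=> M0 /intrP[m ->]; rewrite -[m%:~R]add0r mask_Dint mask0.
Qed.

Lemma mask_conj M n x : conjc (mask M n x) = mask M n (- x).
Proof.
rewrite /mask conjcM conjc_inv conjc_nat conjc_sum; congr (_ * _).
by apply: eq_bigr => i _; rewrite e_conj mulrN.
Qed.

Lemma mask_zpow M n x : (0 < M)%N -> mask M n x =
  M%:R^-1 * (\sum_(0 <= i < M.-1) e (- x) ^+ i + e (- x) ^+ (n * M - 1)).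
Proof.
case: M => // M _; rewrite /mask big_ord_recr /= -(big_mkord xpredT
  (fun i => e (- ((digit M.+1 n i)%:R * x)))); congr (_ * (_ + _)).
  by apply: eq_big_nat => i /andP[_ iM]; rewrite /digit /= iM -mulrN e_natl.
by rewrite /digit ltnn -mulrN e_natl.
Qed.

(** Multiplying the sum by z - 1 gives z^(M-1) - 1 = - (z - 1) z^(nM-1), so that
    z^(M-1) and z are at the same distance from 1: z^(M-1) is z or its conjugate.
    In the second case z^M = 1. In the first, z^(M-2) = 1 and z^(nM-1) = -1; for
    odd M raising to the power M - 2 gives 1 = -1, and for even M >= 5 the two
    relations and coprimality give z^2 = 1. For M = 4 one has z^2 = 1 at once. *)
Lemma mask_root (M n : nat) (z : C) : (3 <= M)%N -> (1 <= n)%N ->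
  (~~ odd M -> (5 <= M)%N -> gcdn (n * M - 1) (M - 2) = 1%N) ->
  nsq z = 1 -> \sum_(0 <= i < M.-1) z ^+ i + z ^+ (n * M - 1) = 0 ->
  z ^+ M = 1.
Proof.
move=> M3 n1 hgcd z1 hz.
have z0 : z != 0 by rewrite -nsq_eq0 z1 oner_eq0.
have zX1 k : nsq (z ^+ k) = 1.
  by elim: k => [|k IH]; rewrite ?expr0 ?nsq1// exprS nsqM z1 IH mulr1.
have [->|zn1] := eqVneq z 1; first by rewrite expr1n.
have zB : z - 1 != 0 by rewrite subr_eq0.
have main : z ^+ M.-1 - 1 = - (z - 1) * z ^+ (n * M - 1).
  rewrite subrX1 -(big_mkord xpredT (fun i => z ^+ i)).
  by move/eqP: hz; rewrite addr_eq0 => /eqP ->; rewrite mulrN mulNr.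
have h3 : nsq (z ^+ M.-1 - 1) = nsq (z - 1).
  by rewrite main nsqM zX1 mulr1 /nsq /=; case: (z) => a b /=; ring.
have MS : M = M.-1.+1 by rewrite prednK// (leq_trans _ M3).
case: (unit_dist_eq (zX1 _) z1 h3) => h; last by rewrite MS exprSr.
have zM2 : z ^+ (M - 2) = 1.
  apply: (mulfI z0); rewrite mulr1 -exprS -[RHS]h; congr (_ ^+ _); lia.
have zn : z ^+ (n * M - 1) = -1.
  by apply: (mulfI zB); rewrite mulrN1 -[in RHS]h main mulNr opprK.
have n21 : (1 : C) <> -1.
  by move/eqP; rewrite -subr_eq0 opprK -(natrD _ 1 1) pnatr_eq0.
have [oM|oM] := boolP (odd M).
  exfalso; apply: n21; have := congr1 (fun w => w ^+ (n * M - 1)) zM2.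
  rewrite /= expr1n exprAC zn -signr_odd oddB ?oM ?expr1 => [->//|].
  by rewrite (leq_trans _ M3).
have [M5|M5] := leqP 5 M; last first.
  have M4 : M = 4%N by move: M3 M5 oM; case: (M) => [|[|[|[|[|]]]]].
  by move: zM2; rewrite M4 => h2; rewrite (exprM z 2 2) h2 expr1n.
have g := hgcd oM M5.
have zn2 : z ^+ ((n * M - 1) * 2) = 1 by rewrite exprM zn sqrrN expr1n.
have z2 : z ^+ 2 = 1.
  have nM0 : (0 < n * M - 1)%N by nia.
  case: (egcdnP (M - 2) nM0) => a b; rewrite g => hab _.
  have : z ^+ ((a * (n * M - 1)) * 2) = z ^+ ((b * (M - 2) + 1) * 2).
    by rewrite hab.
  rewrite -mulnA mulnC exprM zn2 expr1n mulnDl exprD mul1n.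
  by rewrite -mulnA mulnCA exprM zM2 expr1n mul1r => <-.
by rewrite -[M]odd_double_half (negbTE oM) add0n -muln2 mulnC exprM z2 expr1n.
Qed.

(** The zeros of the mask lie in the lattice (1/M) Z: this is where coprimality
    of the last digit with M - 2 matters. *)
Lemma mask_eq0 (M n : nat) x : (3 <= M)%N -> (1 <= n)%N ->
  (~~ odd M -> (5 <= M)%N -> gcdn (n * M - 1) (M - 2) = 1%N) ->
  mask M n x = 0 -> M%:R * x \is a Num.int.
Proof.
move=> M3 n1 hg; have M0 : (0 < M)%N by rewrite (leq_trans _ M3).
rewrite mask_zpow// => /eqP; rewrite mulf_eq0 invr_eq0 pnatr_eq0.
rewrite -leqn0 leqNgt M0 /= => /eqP hz.
have := mask_root M3 n1 hg (nsq_e _) hz; rewrite -e_natl => /e_eq1.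
by rewrite mulrN rpredN.
Qed.

Lemma sum_e_roots (M : nat) (a : int) : (0 < M)%N ->
  \sum_(h < M) e (a%:~R * (h%:R / M%:R)) =
  (if (M%:Z %| a)%Z then M%:R else 0) :> C.
Proof.
move=> M0; have MR : (M%:R : R) != 0 by rewrite pnatr_eq0 -lt0n.
have -> : \sum_(h < M) e (a%:~R * (h%:R / M%:R)) =
    \sum_(h < M) e (a%:~R / M%:R) ^+ h :> C.
  apply: eq_bigr => h _; rewrite -e_natl; congr e.
  by rewrite mulrCA.
have w1 : e (a%:~R / M%:R) ^+ M = 1 :> C.
  by rewrite -e_natl mulrC mulfVK// e_int.
case: ifPn => [/dvdzP[q ->]|nd].
  rewrite intrM -[M%:Z%:~R]/(M%:R) mulfK// e_int.
  by rewrite (eq_bigr (fun=> 1)) ?sumr_const ?card_ord// => i _; rewrite expr1n.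
have /mulfI : e (a%:~R / M%:R) - 1 != 0 :> C.
  rewrite subr_eq0; apply/negP => /eqP/e_eq1/intrP[q hq].
  move/negP: nd; apply; apply/dvdzP; exists q.
  by apply: (@intr_inj R); rewrite intrM -hq -[M%:Z%:~R]/(M%:R) mulfVK.
by apply; rewrite mulr0 -subrX1 w1 subrr.
Qed.

Lemma digit_mod M n i : (0 < n)%N -> (i < M)%N -> digit M n i = i %[mod M].
Proof.
move=> n0 iM; rewrite /digit; case: ltnP => // Mi.
have -> : i = M.-1 by lia.
have -> : (n * M - 1 = n.-1 * M + M.-1)%N by nia.
by rewrite modnMDl.
Qed.

(** The digits are distinct modulo M, so that the characters of Z/M kill all but
    the diagonal terms of the double sum over pairs of digits. The shifts may use
    any representatives l of the residues, by periodicity. *)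
Lemma sum_wmask (M n : nat) x (l : nat -> int) : (0 < M)%N -> (0 < n)%N ->
  (forall h, (h < M)%N -> (l h = h%:Z %[mod M])%Z) ->
  \sum_(h < M) wmask M n (x - (l h)%:~R / M%:R) = 1.
Proof.
move=> M0 n0 hl; have MR : (M%:R : R) != 0 by rewrite pnatr_eq0 -lt0n.
have MC : (M%:R : C) != 0 by rewrite pnatr_eq0 -lt0n.
apply: complexI; rewrite rmorph_sum /=.
pose d i j : R := (digit M n i)%:R - (digit M n j)%:R.
have -> : \sum_(h < M) (wmask M n (x - (l h)%:~R / M%:R))%:C%C =
    \sum_(h < M) M%:R^-1 ^+ 2 * \sum_(i < M) \sum_(j < M)
       e (- (d i j * x)) * e (d i j * (h%:R / M%:R)) :> C.
  apply: eq_bigr => h _; rewrite nsqE mask_conj /mask mulrACA -expr2.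
  congr (_ * _); rewrite mulr_suml; apply: eq_bigr => i _.
  rewrite mulr_sumr; apply: eq_bigr => j _; rewrite -!eD.
  have /eqP := hl h (ltn_ord h); rewrite eqz_mod_dvd => /dvdzP[q hq].
  have -> : (l h)%:~R = h%:R + q%:~R * M%:R :> R.
    by rewrite -[h%:R]/(h%:Z%:~R) -[M%:R]/(M%:Z%:~R) -intrM -hq -intrD addrC subrK.
  rewrite -[RHS](eDint _ (((digit M n i)%:Z - (digit M n j)%:Z) * q)).
  congr e; rewrite /d intrM intrB; field.
  exact: MR.
rewrite -mulr_sumr exchange_big /=.
have -> : \sum_(i < M) \sum_(h < M) \sum_(j < M)
       e (- (d i j * x)) * e (d i j * (h%:R / M%:R)) = \sum_(i < M) (M%:R : C).
  apply: eq_bigr => i _; rewrite exchange_big /= (bigD1 i)//=.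
  rewrite [X in _ + X]big1 => [|j ji].
    rewrite addr0 (eq_bigr (fun=> 1)) ?sumr_const ?card_ord// => h _.
    by rewrite /d subrr !mul0r oppr0 e0 mulr1.
  rewrite -mulr_sumr.
  have -> : \sum_(h < M) e (d i j * (h%:R / M%:R)) =
    \sum_(h < M) e (((digit M n i)%:Z - (digit M n j)%:Z)%:~R * (h%:R / M%:R)) :> C.
    by apply: eq_bigr => h _; rewrite intrB.
  rewrite sum_e_roots// ifF ?mulr0//; apply/negP.
  rewrite -eqz_mod_dvd !modz_nat eqz_nat !digit_mod// !modn_small// => /eqP ij.
  by move/eqP: ji; apply; apply/val_inj.
have -> : \sum_(i < M) (M%:R : C) = M%:R ^+ 2.
  by rewrite sumr_const card_ord expr2 mulr_natr.
by rewrite -exprMn mulVf// expr1n.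
Qed.

Lemma sin_le_id x : 0 < x -> sin x <= x.
Proof.
move=> x0; have [x1|x1] := ltP x 1; last exact: le_trans (sin_le1 x) x1.
pose f := fun y : R => y - sin y.
have df (y : R) : is_derive y 1 f (1 - cos y) by apply: is_deriveB.
have : f 0 <= f x.
  apply: (@ger0_derive1_le_cc _ f 0 x) => //.
  - by move=> y _; rewrite derive1E (@derive_val _ _ _ _ _ _ _ (df y)) subr_ge0 cos_le1.
  - apply: continuous_subspaceT => y.
    by apply: differentiable_continuous; apply/derivable1_diffP; exact: (@ex_derive _ _ _ _ _ _ _ (df y)).
  - by rewrite in_itv/= lexx ltW.
  - by rewrite in_itv/= lexx ltW.
  - exact: ltW.
by rewrite /f sin0 subr0 subr_ge0.
Qed.

Lemma cos_ge x : 1 - x ^+ 2 / 2 <= cos x.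
Proof.
have key y : sin y ^+ 2 <= y ^+ 2.
  wlog y0 : y / 0 < y => [hw|].
    have [y0|y0|<-] := ltgtP 0 y; [exact: hw| |by rewrite sin0].
    by have := hw (- y); rewrite sinN !sqrrN; apply; rewrite oppr_gt0.
  have [y1|y1] := ltP y 1; last first.
    apply: le_trans (_ : 1 <= _); last by rewrite exprn_ege1.
    by rewrite -(cos2Dsin2 y) lerDr sqr_ge0.
  rewrite ler_sqr ?nnegrE ?sin_le_id ?(ltW y0)//.
  apply: sin_ge0_pi; rewrite ltW//= (le_trans (ltW y1))//.
  by apply: le_trans (pi_ge2 R); rewrite ler1n.
have -> : cos x = cos (x / 2 *+ 2) by rewrite -mulr_natr divfK ?pnatr_eq0.
have := key (x / 2); rewrite expr_div_n.
rewrite cos_mulr2n cos2sin2; move: (sin _ ^+ 2) => s; rewrite -mulr_natr.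
by move=> h; lra.
Qed.

Lemma pi_lt4 : pi < 4 :> R.
Proof. have := pihalf_lt2 R; lra. Qed.

(** A rotation e t is free, and makes the lower bound of a real part efficient. *)
Lemma Re_wmask M n x (a t : R) : 0 <= a ->
  a <= complex.Re (e t * mask M n x) -> a ^+ 2 <= wmask M n x.
Proof.
move=> a0 ha; rewrite /wmask -[leRHS]mul1r -(nsq_e t) -nsqM.
move: (e t * _) ha => [b c] /= ha; rewrite /nsq /=.
have : a ^+ 2 <= b ^+ 2 by rewrite ler_sqr ?nnegrE// (le_trans a0).
by have := sqr_ge0 c; lra.
Qed.

Lemma Re_e_mask M n x t : complex.Re (e t * mask M n x) =
  M%:R^-1 * \sum_(i < M) cos (2 * pi * (t - (digit M n i)%:R * x)).
Proof.
rewrite /mask mulrCA natVC ReMl mulr_sumr Re_sum; congr (_ * _).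
by apply: eq_bigr => i _; rewrite -eD.
Qed.

(** The constant 32 bounds (2 pi)^2 / 2, using only pi < 4. *)
Lemma cos_2pi_ge x : 1 - 32 * x ^+ 2 <= cos (2 * pi * x).
Proof.
apply: le_trans (cos_ge _); rewrite lerD2l lerN2 !exprMn.
have p2 : pi ^+ 2 <= 4 ^+ 2 :> R.
  by rewrite ler_sqr ?nnegrE ?pi_ge0 ?ler0n ?ltW ?pi_lt4.
have := ler_wpM2r (sqr_ge0 x) p2; lra.
Qed.

(** Near 0 the M - 1 small digits contribute almost 1 each, and the last one,
    possibly huge, costs at most 2 out of M. *)
Lemma wmask_ge_tail M n x : (0 < M)%N ->
  1 - 4 / M%:R - 64 * (M%:R * x) ^+ 2 <= wmask M n x.
Proof.
case: M => // K _; set y := K.+1%:R * x.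
have M0 : (0 : R) < K.+1%:R by rewrite ltr0n.
suff h : 1 - 2 / K.+1%:R - 32 * y ^+ 2 <= complex.Re (mask K.+1 n x).
  rewrite /wmask; move: (mask _ _ _) h => [a b] /=; rewrite /nsq /= => h.
  have -> : 4 / K.+1%:R = 2 * (2 / K.+1%:R) :> R by rewrite mulrA -natrM.
  have := sqr_ge0 (a - 1); have := sqr_ge0 b.
  by move: h; move: (2 / _) (y ^+ 2) => u v; lra.
rewrite -[mask _ _ _]mul1r -e0 Re_e_mask big_ord_recr /=.
rewrite -ler_pdivrMl ?invr_gt0// invrK.
have hs : \sum_(i < K) (1 - 32 * y ^+ 2) <=
   \sum_(i < K) cos (2 * pi * (0 - (digit K.+1 n i)%:R * x)).
  apply: ler_sum => i _; apply: le_trans (cos_2pi_ge _).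
  rewrite sub0r sqrrN lerD2l lerN2 ler_wpM2l// /y !exprMn ler_wpM2r ?sqr_ge0//.
  rewrite ler_sqr ?nnegrE ?ler0n// ler_nat /digit /= ltn_ord.
  exact: leq_trans (ltnW (ltn_ord i)) _.
apply: le_trans (lerD hs (cos_geN1 _)); rewrite sumr_const card_ord.
rewrite -mulr_natr !mulrBr mulr1 mulrCA divff ?gt_eqF// mulr1.
rewrite -natr1 !mulrDl mul1r; have := sqr_ge0 y.
move: (y ^+ 2) => z z0; have := mulr_ge0 (ler0n R K) z0; lra.
Qed.

Lemma sum_sqr_dist (a : R) (K : nat) : \sum_(i < K) (a - i%:R) ^+ 2 =
  K%:R * a ^+ 2 - a * K%:R * (K%:R - 1) + K%:R * (K%:R - 1) * (2 * K%:R - 1) / 6.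
Proof.
elim: K => [|K IH]; first by rewrite big_ord0; lra.
by rewrite big_ord_recr /= IH -natr1; field.
Qed.

(** Rotating by the middle of 0, ..., M - 2 centres these digits, whose mean square
    then is about M^2 / 12 rather than M^2 / 3; this keeps the average of the
    cosines positive up to M x = 14/25, a little beyond the 1/2 which is needed
    for frequencies reduced modulo 1. *)
Lemma wmask_ge_first M n x : (100 <= M)%N -> `|M%:R * x| <= 14 / 25 ->
  1 / 100 <= wmask M n x.
Proof.
case: M => // K hK hy.
have M0 : (0 : R) < K.+1%:R by rewrite ltr0n.
rewrite (_ : 1 / 100 = (1 / 10) ^+ 2); last by rewrite expr_div_n expr1n -natrX.
apply: (@Re_wmask _ _ _ _ ((K%:R - 1) / 2 * x)); first by lra.
rewrite Re_e_mask big_ord_recr /= -ler_pdivrMl ?invr_gt0// invrK.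
set c := (K%:R - 1) / 2.
have hs : \sum_(i < K) (1 - 32 * x ^+ 2 * (c - i%:R) ^+ 2) <=
   \sum_(i < K) cos (2 * pi * (c * x - (digit K.+1 n i)%:R * x)).
  apply: ler_sum => i _; apply: le_trans (cos_2pi_ge _).
  by rewrite /digit /= ltn_ord -mulrBl exprMn; lra.
apply: le_trans (lerD hs (cos_geN1 _)); rewrite big_split /= sumrN -mulr_sumr.
rewrite sum_sqr_dist sumr_const card_ord.
have k99 : (99 : R) <= K%:R by rewrite ler_nat.
have hx : (K.+1%:R * x) ^+ 2 <= (14 / 25) ^+ 2.
  by rewrite -real_normK ?num_real// ler_sqr ?nnegrE//; lra.
have hx2 : (K%:R * x) ^+ 2 <= (14 / 25) ^+ 2.
  apply: le_trans hx; rewrite !exprMn ler_wpM2r ?sqr_ge0//.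
  by rewrite ler_sqr ?nnegrE ?ler0n// ler_nat.
rewrite -natr1; move: hx2; rewrite /c !exprMn.
move: (K%:R) k99 => k k99; set u := x ^+ 2 => h.
have u0 : 0 <= u by exact: sqr_ge0.
have : k * (k ^+ 2 * u) <= k * ((14 / 25) ^+ 2).
  by apply: ler_wpM2l => //; lra.
have : 0 <= k * u by apply: mulr_ge0 => //; lra.
lra.
Qed.

End Mask.

(** * Componentwise limits of complex sequences *)

Section ComplexLimits.
Context {R : realType}.
Local Notation C := R[i].

(** Componentwise convergence, the form in which weak convergence delivers it. *)
Definition ccvg (u : nat -> C) (l : C) : Prop :=
  complex.Re (u n) @[n --> \oo] --> complex.Re l /\
  complex.Im (u n) @[n --> \oo] --> complex.Im l.

Implicit Types (u v : nat -> C) (l m : C).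

Lemma ccvg_cst l : ccvg (fun=> l) l.
Proof. by split; exact: cvg_cst. Qed.

Lemma ccvgD u v l m : ccvg u l -> ccvg v m -> ccvg (fun n => u n + v n) (l + m).
Proof.
move=> [ur ui] [vr vi]; split.
- by rewrite ReD; under eq_fun do rewrite ReD; exact: cvgD.
- by rewrite ImD; under eq_fun do rewrite ImD; exact: cvgD.
Qed.

Lemma ReM (z w : C) : complex.Re (z * w) =
  complex.Re z * complex.Re w - complex.Im z * complex.Im w.
Proof. by case: z w => [a b] [c d]. Qed.

Lemma ImM (z w : C) : complex.Im (z * w) =
  complex.Re z * complex.Im w + complex.Im z * complex.Re w.
Proof. by case: z w => [a b] [c d]. Qed.

Lemma ccvgM u v l m : ccvg u l -> ccvg v m -> ccvg (fun n => u n * v n) (l * m).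
Proof.
move=> [ur ui] [vr vi]; split.
- by rewrite ReM; under eq_fun do rewrite ReM; apply: cvgB; exact: cvgM.
- by rewrite ImM; under eq_fun do rewrite ImM; apply: cvgD; exact: cvgM.
Qed.

Lemma ccvg_sum (I : eqType) (s : seq I) (u : I -> nat -> C) (l : I -> C) :
  (forall i, i \in s -> ccvg (u i) (l i)) ->
  ccvg (fun n => \sum_(i <- s) u i n) (\sum_(i <- s) l i).
Proof.
elim: s => [|a s IH] h.
  rewrite big_nil; have -> : (fun n => \sum_(i <- [::]) u i n) = fun=> 0.
    by apply/funext => n; rewrite big_nil.
  exact: ccvg_cst.
rewrite big_cons; have -> : (fun n => \sum_(i <- a :: s) u i n) =
  fun n => u a n + \sum_(i <- s) u i n.
  by apply/funext => n; rewrite big_cons.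
apply: ccvgD; first by apply: h; rewrite mem_head.
by apply: IH => i si; apply: h; rewrite inE si orbT.
Qed.

Lemma ccvg_eventually u v l n0 : (forall n, (n0 <= n)%N -> u n = v n) ->
  ccvg u l -> ccvg v l.
Proof.
move=> uv [ur ui]; split.
- apply: cvg_trans ur; apply: near_eq_cvg.
  by exists n0 => // n /= hn; rewrite uv.
- apply: cvg_trans ui; apply: near_eq_cvg.
  by exists n0 => // n /= hn; rewrite uv.
Qed.

Lemma ccvg_nsq u l : ccvg u l -> nsq (u n) @[n --> \oo] --> nsq l.
Proof.
by move=> [ur ui]; apply: cvgD; rewrite expr2; under eq_fun do rewrite expr2;
   exact: cvgM.
Qed.

Lemma ccvg_unique u l m : ccvg u l -> ccvg u m -> l = m.
Proof.
move=> [ur ui] [vr vi]; case: l m ur ui vr vi => [a b] [c d] /= ur ui vr vi.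
by congr Complex; [apply: cvg_unique ur vr | apply: cvg_unique ui vi].
Qed.

End ComplexLimits.

(** * Positive definite functions and Bessel's inequality *)

Section PositiveDefinite.
Context {R : realType}.
Local Notation C := R[i].

(** The Hermitian form of the kernel phi (x - y) at the weighted points of s. *)
Definition qform (phi : R -> C) (s : seq (C * R)) : R :=
  complex.Re (\sum_(p <- s) \sum_(q <- s) p.1 * conjc q.1 * phi (p.2 - q.2)).

(** Positive definiteness. Unlike being the Fourier transform of a measure, it
    passes to pointwise limits for free, and it is all that Bessel's inequality
    needs; no measure has to be built for a product of masks with some levels left
    out. *)
Definition posdef (phi : R -> C) : Prop := forall s, 0 <= qform phi s.

Lemma posdef1 : posdef (fun=> 1).
Proof.
move=> s; have -> : qform (fun=> 1) s = nsq (\sum_(p <- s) p.1); last exact: nsq_ge0.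
rewrite /qform -[RHS]/(complex.Re (nsq (\sum_(p <- s) p.1))%:C%C) nsqE.
congr complex.Re; rewrite conjc_sum mulr_suml; apply: eq_bigr => p _.
by rewrite mulr_sumr; apply: eq_bigr => q _; rewrite mulr1.
Qed.

Lemma posdef_e (phi : R -> C) t : posdef phi -> posdef (fun x => e (t * x) * phi x).
Proof.
move=> h s; have := h [seq (p.1 * e (t * p.2), p.2) | p <- s].
rewrite /qform big_map; congr (_ <= complex.Re _); apply: eq_bigr => p _.
rewrite big_map; apply: eq_bigr => q _ /=.
by rewrite conjcM e_conj mulrBr eD; ring.
Qed.

(** A mask is an average of characters, which are absorbed by the coefficients. *)
Lemma posdef_mask (phi : R -> C) M n a : posdef phi ->
  posdef (fun x => mask M n (x / a) * phi x).
Proof.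
move=> h s.
have -> : qform (fun x => mask M n (x / a) * phi x) s = M%:R^-1 *
  \sum_(i < M) qform (fun x => e (- ((digit M n i)%:R / a) * x) * phi x) s.
  have E z : mask M n (z / a) * phi z =
      M%:R^-1 * \sum_(i < M) e (- ((digit M n i)%:R / a) * z) * phi z.
    rewrite /mask -mulrA mulr_suml; congr (_ * _); apply: eq_bigr => i _.
    by congr (e _ * _); rewrite mulNr mulrA mulrAC.
  rewrite /qform -Re_sum -ReMl -natVC; congr complex.Re.
  under eq_bigr => p _ do under eq_bigr => q _ do rewrite E mulrCA mulr_sumr.
  rewrite [in RHS]exchange_big mulr_sumr; apply: eq_bigr => p _ /=.
  by rewrite [in RHS]exchange_big mulr_sumr; apply: eq_bigr => q _ /=.
apply: mulr_ge0; first by rewrite invr_ge0.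
by apply: sumr_ge0 => i _; apply: posdef_e.
Qed.

Lemma qform_cvg (phi_ : nat -> R -> C) (phi : R -> C) (s : seq (C * R)) :
  (forall p q, p \in s -> q \in s ->
     ccvg (phi_ ^~ (p.2 - q.2)) (phi (p.2 - q.2))) ->
  qform (phi_ n) s @[n --> \oo] --> qform phi s.
Proof.
move=> h; apply: (proj1 (ccvg_sum _)) => p sp; apply: ccvg_sum => q sq.
by apply: ccvgM; [exact: ccvg_cst | exact: h].
Qed.

Definition proj_error xi (F : seq R) (c : R -> C) : seq (C * R) :=
  (1, xi) :: [seq (- c x, x) | x <- F].

(** The familiar expansion of the squared distance from the exponential of
    frequency xi to a combination of orthonormal exponentials. *)
Lemma qform_proj_error (phi : R -> C) xi (F : seq R) (c : R -> C) :
  phi 0 = 1 -> uniq F ->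
  (forall x, x \in F -> phi (x - xi) = conjc (phi (xi - x))) ->
  (forall x y, x \in F -> y \in F -> x != y -> phi (x - y) = 0) ->
  qform phi (proj_error xi F c) = 1 - \sum_(x <- F) nsq (phi (xi - x)) +
    \sum_(x <- F) nsq (c x - phi (xi - x)).
Proof.
move=> phi0 uF hF oF; rewrite /qform /proj_error big_cons big_cons /=.
rewrite conjc1 mul1r subrr phi0 mul1r !big_map /=.
have -> : \sum_(x <- F) \sum_(q <- (1, xi) :: [seq (- c x, x) | x <- F])
    - c x * conjc q.1 * phi (x - q.2) =
    \sum_(x <- F) (- c x * conjc (phi (xi - x)) + c x * conjc (c x)).
  apply: eq_big_seq => x xF; rewrite big_cons /= conjc1 mulr1 hF// big_map /=.
  congr (_ + _); rewrite (bigD1_seq x)//= big1_seq => [|y /andP[yx yF]]; last first.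
    by rewrite oF ?mulr0// eq_sym.
  by rewrite addr0 subrr phi0 mulr1 conjcN mulrNN.
rewrite !ReD !Re_sum -!addrA; congr (_ + _).
rewrite -sumrN -!big_split /=; apply: eq_bigr => x _.
move: (c x) (phi (xi - x)) => [a b] [d f].
by rewrite /nsq /conjc /=; ring.
Qed.

(** The form is nonnegative at the error of the orthogonal projection.
    Convergence to phi is required at the occurring differences only, because phi
    will be a quotient that makes no sense at the zeros of its denominator. *)
Lemma bessel_posdef (phi_ : nat -> R -> C) (phi : R -> C) xi (F : seq R) :
  (forall n, posdef (phi_ n)) -> phi 0 = 1 -> uniq F ->
  (forall x, x \in F -> phi (x - xi) = conjc (phi (xi - x))) ->
  (forall x y, x \in F -> y \in F -> x != y -> phi (x - y) = 0) ->
  (forall x y, x \in xi :: F -> y \in xi :: F -> ccvg (phi_ ^~ (x - y)) (phi (x - y))) ->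
  \sum_(x <- F) nsq (phi (xi - x)) <= 1.
Proof.
move=> pd phi0 uF hF oF cF; pose c x := phi (xi - x).
have := qform_proj_error c phi0 uF hF oF.
rewrite [X in _ + X]big1 ?addr0 => [Eq|x _]; last by rewrite subrr nsq0.
rewrite -subr_ge0 -Eq.
have := @qform_cvg phi_ phi (proj_error xi F c); move=> /(_ _)/cvgr_to_ge; apply.
  move=> p q hp hq; apply: cF.
    by move: hp; rewrite inE => /orP[/eqP->|/mapP[x xF ->]]; rewrite inE ?eqxx// xF orbT.
  by move: hq; rewrite inE => /orP[/eqP->|/mapP[x xF ->]]; rewrite inE ?eqxx// xF orbT.
by apply: nearW => n; exact: pd.
Qed.

End PositiveDefinite.

(** * Fourier transforms of the finite convolutions *)

Section Transforms.
Context {R : realType}.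
Local Notation RR := (measurableTypeR R).
Local Notation C := R[i].

Lemma ge0_integral_delta_fset (A : {fset R}) (g : RR -> \bar R) :
  measurable_fun [set: RR] g -> (forall x, 0 <= g x)%E ->
  (\int[delta_fset A]_x g x = (#|` A|%:R^-1)%:E * \sum_(a <- A) g a)%E.
Proof.
move=> mg g0; have rge0 : 0 <= (#|` A|%:R^-1 : R) by rewrite invr_ge0.
rewrite (eq_measure_integral (mscale (NngNum rge0)
    (msum (fun i => \d_((A : seq R)`_i : RR)) #|` A|))); last first.
  move=> U mU _; rewrite /= /delta_fset /mscale /msum /=.
  by rewrite (big_nth 0) big_mkord.
rewrite ge0_integral_mscale//= ge0_integral_measure_sum//; congr (_ * _)%E.
rewrite (big_nth 0) big_mkord; apply: eq_bigr => i _.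
by rewrite integral_dirac// diracT mul1e.
Qed.

(** Tonelli, with the sum over A as inner integral. *)
Lemma ge0_integral_convolution (mu : {finite_measure set RR -> \bar R})
    (A : {fset R}) (g : RR -> \bar R) :
  measurable_fun [set: RR] g -> (forall x, 0 <= g x)%E ->
  (\int[convolution mu (delta_fset A)]_x g x =
   (#|` A|%:R^-1)%:E * \sum_(a <- A) \int[mu]_x g (x + a)%R)%E.
Proof.
move=> mg g0.
have madd : measurable_fun [set: RR * RR] (fun z : RR * RR => z.1 + z.2 : RR).
  exact: (measurable_realfun.measurable_funD measurable_fst measurable_snd).
have mshift a : measurable_fun [set: RR] (fun x : RR => g (x + a)).
  by apply: (measurableT_comp mg); exact: measurable_funD.
have -> : (\int[convolution mu (delta_fset A)]_x g x =
    \int[pushforward (mu \x delta_fset A) (fun z : RR * RR => (z.1 + z.2)%R : RR)]_x g x)%E.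
  exact: eq_measure_integral.
rewrite ge0_integral_pushforward// preimage_setT.
rewrite fubini_tonelli1//=; last exact: (measurableT_comp mg madd).
have E x : fubini_F (delta_fset A) (g \o (fun z : RR * RR => z.1 + z.2 : RR)) x =
   ((#|` A|%:R^-1)%:E * \sum_(a <- A) g (x + a)%R)%E.
  rewrite /fubini_F /= ge0_integral_delta_fset//.
  by apply: (measurableT_comp mg); exact: measurable_funD.
under eq_integral do rewrite E.
rewrite ge0_integralZl//=.
- by rewrite ge0_integral_sum.
- exact: emeasurable_sum.
- by move=> x _; exact: sume_ge0.
Qed.

Lemma bounded_integrable (mu : {finite_measure set RR -> \bar R}) (f : RR -> R) (K : R) :
  measurable_fun [set: RR] f -> (forall x, `|f x| <= K) ->
  mu.-integrable setT (EFin \o f).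
Proof.
move=> mf fK; apply: measurable_bounded_integrable => //.
  by rewrite ltey_eq fin_num_measure.
exists K; split; first exact: num_real.
by move=> y Ky x _ /=; rewrite (le_trans (fK x))// ltW.
Qed.

(** Adding 1 to f makes it nonnegative, and the constant 1 is nonnegative too. *)
Lemma Rintegral_convolution (mu : {finite_measure set RR -> \bar R})
    (A : {fset R}) (f : RR -> R) :
  measurable_fun [set: RR] f -> (forall x, `|f x| <= 1) ->
  \int[convolution mu (delta_fset A)]_x f x =
   #|` A|%:R^-1 * \sum_(a <- A) \int[mu]_x f (x + a).
Proof.
move=> mf f1.
have ge0_case (g : RR -> R) K : measurable_fun [set: RR] g ->
    (forall x, 0 <= g x) -> (forall x, `|g x| <= K) ->
    \int[convolution mu (delta_fset A)]_x g x =
    #|` A|%:R^-1 * \sum_(a <- A) \int[mu]_x g (x + a).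
  move=> mg g0 gK; have mg' : measurable_fun [set: RR] (EFin \o g).
    exact/measurable_EFinP.
  rewrite /Rintegral (ge0_integral_convolution _ _ mg')//=.
  have fin a : (\int[mu]_x (g (x + a)%R)%:E)%E \is a fin_num.
    apply: integrable_fin_num => //.
    apply: (@bounded_integrable _ (fun x => g (x + a)) K) => //.
    by apply: (measurableT_comp mg); exact: measurable_funD.
  rewrite fineM//; last by apply/sum_fin_numP => a _ _.
  by rewrite /= sum_fine.
have mshift a : measurable_fun [set: RR] (fun x : RR => f (x + a)).
  by apply: (measurableT_comp mf); exact: measurable_funD.
have split (nu : {finite_measure set RR -> \bar R}) (g : RR -> R) :
    measurable_fun [set: RR] g -> (forall x, `|g x| <= 1) ->
    \int[nu]_x g x = \int[nu]_x (g x + 1) - \int[nu]_x 1.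
  move=> mg g1; rewrite RintegralD// ?addrK//.
    exact: bounded_integrable g1.
  by apply: (@bounded_integrable _ _ 1) => // x; rewrite normr1.
rewrite split// (ge0_case _ 2) => [|||x]; last 3 first.
- exact: measurable_funD.
- by move=> x; have := f1 x; rewrite ler_norml => /andP[+ _]; lra.
- by rewrite (le_trans (ler_normD _ _))// normr1; have := f1 x; lra.
rewrite (ge0_case (fun=> 1) 1)//; last by move=> x; rewrite normr1.
rewrite -mulrBr -sumrB; congr (_ * _); apply: eq_bigr => a _.
by rewrite -split.
Qed.

Definition cintegrable (mu : {measure set RR -> \bar R}) (f : RR -> C) : Prop :=
  mu.-integrable setT (EFin \o (fun x => complex.Re (f x))) /\
  mu.-integrable setT (EFin \o (fun x => complex.Im (f x))).

Lemma cintegrableD (mu : {measure set RR -> \bar R}) (f g : RR -> C) :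
  cintegrable mu f -> cintegrable mu g -> cintegrable mu (fun x => f x + g x).
Proof.
move=> [fr fi] [gr gi]; split.
- apply: eq_integrable (integrableD measurableT fr gr) => // x _.
  by rewrite /= ReD.
- apply: eq_integrable (integrableD measurableT fi gi) => // x _.
  by rewrite /= ImD.
Qed.

Lemma cintegralD (mu : {measure set RR -> \bar R}) (f g : RR -> C) :
  cintegrable mu f -> cintegrable mu g ->
  cintegral mu (fun x => f x + g x) = cintegral mu f + cintegral mu g.
Proof.
move=> [fr fi] [gr gi]; rewrite /cintegral; simpc; congr Complex.
- by rewrite -RintegralD//; apply: eq_Rintegral => x _; rewrite ReD.
- by rewrite -RintegralD//; apply: eq_Rintegral => x _; rewrite ImD.
Qed.

Lemma cintegrableZ (mu : {measure set RR -> \bar R}) (c : C) (f : RR -> C) :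
  cintegrable mu f -> cintegrable mu (fun x => c * f x).
Proof.
move=> [fr fi]; split.
- apply: eq_integrable (integrableB measurableT (integrableZl measurableT (complex.Re c) fr)
    (integrableZl measurableT (complex.Im c) fi)) => // x _.
  by rewrite /= ReM EFinB !EFinM.
- apply: eq_integrable (integrableD measurableT (integrableZl measurableT (complex.Re c) fi)
    (integrableZl measurableT (complex.Im c) fr)) => // x _.
  by rewrite /= ImM EFinD !EFinM.
Qed.

Lemma cintegralZ (mu : {measure set RR -> \bar R}) (c : C) (f : RR -> C) :
  cintegrable mu f -> cintegral mu (fun x => c * f x) = c * cintegral mu f.
Proof.
move=> [fr fi]; rewrite /cintegral.
have Zr k : mu.-integrable setT (EFin \o (fun x => k * complex.Re (f x))).
  by apply: eq_integrable (integrableZl measurableT k fr).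
have Zi k : mu.-integrable setT (EFin \o (fun x => k * complex.Im (f x))).
  by apply: eq_integrable (integrableZl measurableT k fi).
apply/eqP; rewrite eq_complex ReM ImM /= -!RintegralZl//.
rewrite -RintegralB// -RintegralD//; apply/andP; split; apply/eqP.
- by apply: eq_Rintegral => x _; rewrite ReM.
- by apply: eq_Rintegral => x _; rewrite ImM.
Qed.

Lemma cintegrable0 (mu : {measure set RR -> \bar R}) : cintegrable mu (fun=> 0).
Proof. by split; exact: integrable0. Qed.

Lemma cintegral0 (mu : {measure set RR -> \bar R}) : cintegral mu (fun=> 0) = 0.
Proof. by rewrite /cintegral /= /Rintegral integral0. Qed.

Lemma cintegrable_sum (mu : {measure set RR -> \bar R}) (I : Type) (s : seq I)
    (f : I -> RR -> C) :
  (forall i, cintegrable mu (f i)) -> cintegrable mu (fun x => \sum_(i <- s) f i x).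
Proof.
move=> hf; elim: s => [|a s IH].
  have -> : (fun x => \sum_(i <- [::]) f i x) = fun=> 0.
    by apply/funext => x; rewrite big_nil.
  exact: cintegrable0.
have -> : (fun x => \sum_(i <- a :: s) f i x) =
  fun x => f a x + \sum_(i <- s) f i x.
  by apply/funext => x; rewrite big_cons.
exact: cintegrableD.
Qed.

Lemma cintegral_sum (mu : {measure set RR -> \bar R}) (I : Type) (s : seq I)
    (f : I -> RR -> C) : (forall i, cintegrable mu (f i)) ->
  cintegral mu (fun x => \sum_(i <- s) f i x) = \sum_(i <- s) cintegral mu (f i).
Proof.
move=> hf; elim: s => [|a s IH].
  rewrite big_nil -[RHS](cintegral0 mu); congr cintegral.
  by apply/funext => x; rewrite big_nil.
rewrite big_cons -IH -cintegralD//; last exact: cintegrable_sum.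
by congr cintegral; apply/funext => x; rewrite big_cons.
Qed.

Lemma expo_e (l : R) (x : RR) : expo l x = e (- (l * x)).
Proof. by rewrite /expo /e mulrN mulrA. Qed.

Lemma continuous_expo (l : R) :
  continuous (fun x : R => complex.Re (expo l x)) /\
  continuous (fun x : R => complex.Im (expo l x)).
Proof.
have h : continuous (fun x : R => - (2 * pi * l * x)).
  by move=> x; apply: cvgN; apply: cvgM; [exact: cvg_cst | exact: cvg_id].
by split => x; apply: (continuous_comp (h x)); [exact: continuous_cos | exact: continuous_sin].
Qed.

Lemma measurable_expo (l : R) :
  measurable_fun [set: RR] (fun x => complex.Re (expo l x)) /\
  measurable_fun [set: RR] (fun x => complex.Im (expo l x)).
Proof.
by have [h1 h2] := continuous_expo l; split; exact: continuous_measurable_fun.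
Qed.

Lemma norm_expo_le1 (l : R) (x : RR) :
  `|complex.Re (expo l x)| <= 1 /\ `|complex.Im (expo l x)| <= 1.
Proof. by split; [exact: cos_max | exact: sin_max]. Qed.

Lemma cintegrable_expo (mu : {finite_measure set RR -> \bar R}) (l : R) :
  cintegrable mu (expo l).
Proof.
have [h1 h2] := measurable_expo l.
by split; apply: (@bounded_integrable _ _ 1) => // x; have [] := norm_expo_le1 l x.
Qed.

Definition fourier (mu : {measure set RR -> \bar R}) (xi : R) : C :=
  cintegral mu (expo xi).

Lemma fourier_conj (mu : {finite_measure set RR -> \bar R}) xi :
  conjc (fourier mu xi) = fourier mu (- xi).
Proof.
rewrite /fourier /cintegral /conjc; congr Complex.
  by apply: eq_Rintegral => x _; rewrite /= mulrN mulNr !cosN.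
rewrite -mulN1r -RintegralZl//; last by case: (cintegrable_expo mu xi).
by apply: eq_Rintegral => x _; rewrite /= mulN1r sinN opprK mulrN mulNr opprK.
Qed.

Lemma fourier_convolution (mu : {finite_measure set RR -> \bar R}) (A : {fset R}) xi :
  fourier (convolution mu (delta_fset A)) xi =
  fourier mu xi * (#|` A|%:R^-1 * \sum_(a <- A) e (- (xi * a))).
Proof.
have [m1 m2] := measurable_expo xi.
transitivity (#|` A|%:R^-1 * \sum_(a <- A) cintegral mu (fun x => expo xi (x + a))).
  apply/eqP; rewrite natVC eq_complex ReMl ImMl Re_sum Im_sum /fourier /=.
  by rewrite !Rintegral_convolution ?eqxx// => x; have [] := norm_expo_le1 xi x.
rewrite [RHS]mulrCA; congr (_ * _); rewrite mulr_sumr; apply: eq_bigr => a _; rewrite [RHS]mulrC.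
rewrite -cintegralZ//; last exact: cintegrable_expo.
congr cintegral; apply/funext => x.
by rewrite !expo_e mulrDr opprD eD mulrC.
Qed.

Lemma fourier_dirac0 xi : fourier (\d_(0 : RR)) xi = 1.
Proof.
rewrite /fourier /cintegral.
have [m1 m2] := measurable_expo xi.
have E (f : RR -> R) : measurable_fun [set: RR] f -> \int[\d_(0 : RR)]_x f x = f 0.
  move=> mf; rewrite /Rintegral integral_dirac//; last exact/measurable_EFinP.
  by rewrite diracT mul1e.
by rewrite !E// /= mulr0 oppr0 cos0 sin0.
Qed.

Definition pprod (N : nat -> nat) (k : nat) : nat := \prod_(1 <= j < k.+1) N j.

Lemma pprod_gt0 (N : nat -> nat) k : (forall i, (1 <= i)%N -> (0 < N i)%N) ->
  (0 < pprod N k)%N.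
Proof.
move=> hN; rewrite /pprod big_nat_cond prodn_cond_gt0// => l.
by rewrite andbT => /andP[l1 _]; exact: hN.
Qed.

Lemma pprodS (N : nat -> nat) k : pprod N k.+1 = (pprod N k * N k.+1)%N.
Proof. by rewrite /pprod big_nat_recr. Qed.

(** The digits are distinct because they are distinct modulo M, so the uniform
    measure on the set of digits gives equal weights along the enumeration. *)
Lemma scaled_digits_perm (N M n : nat -> nat) k :
  (forall i, (1 <= i)%N -> (0 < N i)%N) -> (1 < M k)%N -> (0 < n k)%N ->
  perm_eq (scaled_digits N (fun i => digit_set (M i) (n i)) k)
    [seq ((pprod N k)%:R^-1 * (digit (M k) (n k) i)%:R : R) | i <- iota 0 (M k)].
Proof.
move=> hN M1 n0; apply: uniq_perm; first exact: fset_uniq.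
  rewrite map_inj_in_uniq ?iota_uniq// => i j; rewrite !mem_iota /= !add0n => iM jM.
  have P0 : ((pprod N k)%:R^-1 : R) != 0.
    by rewrite invr_eq0 pnatr_eq0 -lt0n pprod_gt0.
  move/(mulfI P0)/eqP; rewrite eqr_nat => /eqP h.
  have := @digit_mod (M k) (n k) i n0 iM; rewrite h digit_mod//.
  by rewrite !modn_small.
move=> x; apply/imfsetP/mapP; [case=> b | case=> i].
  rewrite !inE /= mem_iota => /orP[/= bM|/eqP ->] ->; last first.
    exists (M k).-1; first by rewrite mem_iota; lia.
    by rewrite /digit ltnn.
  exists b; first by rewrite mem_iota; lia.
  by rewrite /digit ifT//; lia.
rewrite mem_iota => iM ->; exists (digit (M k) (n k) i) => //.
rewrite !inE /= mem_iota /digit; case: ifPn => h; last by rewrite eqxx orbT.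
by apply/orP; left; lia.
Qed.

Definition fourier_fin (N M n : nat -> nat) (k : nat) (xi : R) : C :=
  \prod_(1 <= i < k.+1) mask (M i) (n i) (xi / (pprod N i)%:R).

Lemma fourier_finite_convolution (N M n : nat -> nat) k xi :
  (forall i, (1 <= i)%N -> (0 < N i)%N) -> (forall i, (1 <= i)%N -> (1 < M i)%N) ->
  (forall i, (1 <= i)%N -> (0 < n i)%N) ->
  fourier (finite_convolution N (fun i => digit_set (M i) (n i)) k) xi = fourier_fin N M n k xi.
Proof.
move=> hN hM hn; elim: k => [|k IH].
  by rewrite /fourier_fin big_nil /= fourier_dirac0.
rewrite /= fourier_convolution IH /fourier_fin [in RHS]big_nat_recr//=; congr (_ * _).
have pk := @scaled_digits_perm N M n k.+1 hN (hM k.+1 isT) (hn k.+1 isT).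
rewrite (perm_big _ pk) (perm_size pk) big_map size_map size_iota /mask.
congr (_ * _); rewrite -(big_mkord xpredT (fun i => e (- ((digit (M k.+1) (n k.+1) i)%:R *
   (xi / (pprod N k.+1)%:R))))) /index_iota subn0.
by apply: eq_bigr => i _; congr (e (- _)); rewrite [RHS]mulrC mulrA.
Qed.

Lemma weak_cvg_fourier (mu_ : nat -> {finite_measure set RR -> \bar R})
    (mu : {finite_measure set RR -> \bar R}) xi :
  weak_cvg mu_ mu -> ccvg (fun k => fourier (mu_ k) xi) (fourier mu xi).
Proof.
move=> h; have [c1 c2] := continuous_expo xi.
by split; apply: h => //; exists 1 => x; have [] := norm_expo_le1 xi x.
Qed.

End Transforms.

(** * The square norm *)

Section SquareNorm.
Context {R : realType}.
Local Notation RR := (measurableTypeR R).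
Local Notation C := R[i].

Definition cmeasurable (f : RR -> C) : Prop :=
  measurable_fun [set: RR] (fun x => complex.Re (f x)) /\
  measurable_fun [set: RR] (fun x => complex.Im (f x)).

Definition sqnorm (mu : {measure set RR -> \bar R}) (f : RR -> C) : \bar R :=
  (\int[mu]_x (nsq (f x))%:E)%E.

Lemma cmeasurableD f g : cmeasurable f -> cmeasurable g ->
  cmeasurable (fun x => f x + g x).
Proof.
move=> [f1 f2] [g1 g2]; split.
  by under eq_fun do rewrite ReD; exact: measurable_funD.
by under eq_fun do rewrite ImD; exact: measurable_funD.
Qed.

Lemma cmeasurableM f g : cmeasurable f -> cmeasurable g ->
  cmeasurable (fun x => f x * g x).
Proof.
move=> [f1 f2] [g1 g2]; split.
  by under eq_fun do rewrite ReM; apply: measurable_funB; exact: measurable_funM.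
by under eq_fun do rewrite ImM; apply: measurable_funD; exact: measurable_funM.
Qed.

Lemma cmeasurable_cst (c : C) : cmeasurable (fun=> c).
Proof. by split; exact: measurable_cst. Qed.

Lemma cmeasurableB f g : cmeasurable f -> cmeasurable g ->
  cmeasurable (fun x => f x - g x).
Proof.
move=> hf hg; have -> : (fun x => f x - g x) = fun x => f x + -1 * g x.
  by apply/funext => x; rewrite mulN1r.
by apply: cmeasurableD => //; apply: cmeasurableM => //; exact: cmeasurable_cst.
Qed.

Lemma cmeasurable_expo (l : R) : cmeasurable (expo l).
Proof. exact: measurable_expo. Qed.

Lemma measurable_nsq f : cmeasurable f -> measurable_fun [set: RR] (fun x => nsq (f x)).
Proof.
by move=> [f1 f2]; apply: measurable_funD; apply: measurable_funX.
Qed.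

Lemma measurable_nsqE f : cmeasurable f ->
  measurable_fun [set: RR] (fun x => (nsq (f x))%:E).
Proof. by move=> hf; apply/measurable_EFinP; exact: measurable_nsq. Qed.

Lemma sqnorm_le (mu : {measure set RR -> \bar R}) (k : R) (f g : RR -> C) : 0 <= k ->
  cmeasurable f -> cmeasurable g -> (forall x, nsq (f x) <= k * nsq (g x)) ->
  (sqnorm mu f <= k%:E * sqnorm mu g)%E.
Proof.
move=> k0 mf mg fg; rewrite /sqnorm -ge0_integralZl//; last 2 first.
- exact: measurable_nsqE.
- by move=> x _; rewrite lee_fin nsq_ge0.
apply: ge0_le_integral => //.
- by move=> x _; rewrite lee_fin nsq_ge0.
- exact: measurable_nsqE.
- by apply: measurable_funeM; exact: measurable_nsqE.
- by move=> x _; rewrite -EFinM lee_fin.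
Qed.

Lemma nsqD_le (z w : C) : nsq (z + w) <= 2 * nsq z + 2 * nsq w.
Proof.
case: z w => [a b] [c d]; rewrite /nsq /=.
have := sqr_ge0 (a - c); have := sqr_ge0 (b - d); nra.
Qed.

Lemma sqnormD_le (mu : {measure set RR -> \bar R}) (f g : RR -> C) :
  cmeasurable f -> cmeasurable g ->
  (sqnorm mu (fun x => f x + g x)%R <= 2%:E * sqnorm mu f + 2%:E * sqnorm mu g)%E.
Proof.
move=> mf mg; rewrite /sqnorm.
have m2 h : cmeasurable h -> measurable_fun [set: RR] (fun x => (2 * nsq (h x))%:E).
  move=> mh; apply/measurable_EFinP; apply: measurable_funM => //.
  exact: measurable_nsq.
have p2 h x : (0 <= (2 * nsq (h x : C))%:E)%E by rewrite lee_fin mulr_ge0 ?nsq_ge0.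
rewrite -!ge0_integralZl//; try by
  [exact: measurable_nsqE | move=> x _; rewrite lee_fin nsq_ge0].
rewrite -ge0_integralD//; try by [exact: m2 | move=> x _; exact: p2].
apply: ge0_le_integral => //.
- by move=> x _; rewrite lee_fin nsq_ge0.
- by apply: measurable_nsqE; exact: cmeasurableD.
- by apply: emeasurable_funD; exact: m2.
- by move=> x _; rewrite -!EFinM -EFinD lee_fin; exact: nsqD_le.
Qed.

Lemma normc_sqr (z : C) : ComplexField.Normc.normc z ^+ 2 = nsq z.
Proof. by case: z => a b; rewrite /= sqr_sqrtr ?addr_ge0 ?sqr_ge0. Qed.

Lemma cLnorm2_sqr mu (f : RR -> C) : (cLnorm2 mu f `^ 2)%E = sqnorm mu f.
Proof.
rewrite /cLnorm2 poweR_Lnorm// /sqnorm; apply: eq_integral => x _ /=.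
rewrite powR_mulrn// real_normK ?num_real//.
by rewrite normc_sqr.
Qed.

Lemma poweR2_le (x y : \bar R) : (0 <= x)%E -> (x <= y)%E -> (x `^ 2 <= y `^ 2)%E.
Proof.
move=> x0 xy; apply: (@gt0_ler_poweR R 2 _ x y) => //.
  by rewrite in_itv /= x0 leey.
by rewrite in_itv /= (le_trans x0 xy) leey.
Qed.

Lemma cLnorm2_lt mu (f : RR -> C) (eps : R) : 0 < eps ->
  (sqnorm mu f < (eps ^+ 2)%:E)%E -> (cLnorm2 mu f < eps%:E)%E.
Proof.
move=> e0; rewrite -cLnorm2_sqr !ltNge; apply: contra => h.
rewrite -powR_mulrn ?(ltW e0)// -poweR_EFin.
by apply: poweR2_le => //; rewrite lee_fin ltW.
Qed.

Lemma sqnorm_of_cLnorm2 mu (f : RR -> C) (eps : R) :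
  (cLnorm2 mu f < eps%:E)%E -> (sqnorm mu f <= (eps ^+ 2)%:E)%E.
Proof.
move=> h; have e0 : 0 <= eps.
  by rewrite -lee_fin; apply: le_trans (ltW h); exact: Lnorm_ge0.
rewrite -cLnorm2_sqr -powR_mulrn// -poweR_EFin.
by apply: poweR2_le; [exact: Lnorm_ge0 | exact: ltW].
Qed.

Lemma cLnorm2_lty mu (f : RR -> C) : (cLnorm2 mu f < +oo)%E <-> (sqnorm mu f < +oo)%E.
Proof.
rewrite -cLnorm2_sqr; split; first exact: poweR_lty.
by apply: lty_poweRy.
Qed.

End SquareNorm.

(** * The closure of the trigonometric polynomials *)

Section TrigPolynomials.
Context {R : realType}.
Local Notation RR := (measurableTypeR R).
Local Notation C := R[i].

Definition trig (s : seq (C * R)) (x : RR) : C := \sum_(p <- s) p.1 * expo p.2 x.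

Lemma trig_cat s t x : trig (s ++ t) x = trig s x + trig t x.
Proof. exact: big_cat. Qed.

Lemma trig_scale (c : C) s x : trig [seq (c * p.1, p.2) | p <- s] x = c * trig s x.
Proof.
by rewrite /trig big_map mulr_sumr; apply: eq_bigr => p _; rewrite mulrA.
Qed.

Lemma expoD (l m : R) x : expo (l + m) x = expo l x * expo m x.
Proof. by rewrite !expo_e mulrDl opprD eD. Qed.

Lemma trig_mul s t x :
  trig (allpairs (fun p q => (p.1 * q.1, p.2 + q.2)) s t) x = trig s x * trig t x.
Proof.
rewrite /trig big_allpairs_dep mulr_suml; apply: eq_bigr => p _.
by rewrite mulr_sumr; apply: eq_bigr => q _ /=; rewrite expoD mulrACA.
Qed.

Lemma expo_conj (l : R) x : conjc (expo l x) = expo (- l) x.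
Proof. by rewrite !expo_e e_conj mulNr. Qed.

Lemma trig_conj s x : trig [seq (conjc p.1, - p.2) | p <- s] x = conjc (trig s x).
Proof.
rewrite /trig big_map conjc_sum; apply: eq_bigr => p _.
by rewrite conjcM expo_conj.
Qed.

Lemma cmeasurable_trig s : cmeasurable (trig s).
Proof.
elim: s => [|p s IH].
  have -> : trig [::] = fun=> 0 by apply/funext => x; rewrite /trig big_nil.
  exact: cmeasurable_cst.
have -> : trig (p :: s) = fun x => p.1 * expo p.2 x + trig s x.
  by apply/funext => x; rewrite /trig big_cons.
apply: cmeasurableD => //; apply: cmeasurableM; last exact: cmeasurable_expo.
exact: cmeasurable_cst.
Qed.

Lemma trig_bounded s : exists2 K : R, 0 <= K & forall x, nsq (trig s x) <= K.
Proof.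
elim: s => [|p s [K K0 hK]].
  by exists 0 => // x; rewrite /trig big_nil nsq0.
exists (2 * nsq p.1 + 2 * K) => [|x].
  by rewrite addr_ge0// mulr_ge0// nsq_ge0.
rewrite /trig big_cons; apply: le_trans (nsqD_le _ _) _.
by rewrite nsqM expo_e nsq_e mulr1 lerD2l ler_wpM2l//; exact: hK.
Qed.

Variable mu : {finite_measure set RR -> \bar R}.

(** The closure in L^2(mu) of the trigonometric polynomials with frequencies in
    L, in terms of the squared norm. *)
Definition trig_limit (L : set R) (f : RR -> C) : Prop := cmeasurable f /\
  forall eps : R, 0 < eps -> exists s, {in s, forall p, L p.2} /\
    (sqnorm mu (fun x => f x - trig s x)%R < eps%:E)%E.

Lemma trig_limit_trig (L : set R) s : {in s, forall p, L p.2} -> trig_limit L (trig s).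
Proof.
move=> sL; split=> [|eps e0]; first exact: cmeasurable_trig.
exists s; split => //.
rewrite /sqnorm (eq_integral (cst 0%E)) ?integral0 ?lte_fin// => x _.
by rewrite subrr nsq0.
Qed.

Lemma sqnormD_lt (f g : RR -> C) (eps : R) : cmeasurable f -> cmeasurable g ->
  (sqnorm mu f < (eps / 4)%:E)%E -> (sqnorm mu g < (eps / 4)%:E)%E ->
  (sqnorm mu (fun x => f x + g x)%R < eps%:E)%E.
Proof.
move=> mf mg hf hg; apply: le_lt_trans (sqnormD_le _ mf mg) _.
have -> : eps = 2 * (eps / 4) + 2 * (eps / 4) by lra.
by rewrite [ltRHS]EFinD !EFinM; apply: lteD; rewrite lte_pmul2l.
Qed.

Lemma trig_limit_closed (L : set R) f : cmeasurable f ->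
  (forall eps : R, 0 < eps -> exists2 g, trig_limit L g &
    (sqnorm mu (fun x => f x - g x)%R < eps%:E)%E) -> trig_limit L f.
Proof.
move=> mf h; split => // eps e0.
have e4 : 0 < eps / 4 by rewrite divr_gt0.
have [g [mg hg] fg] := h _ e4; have [s [sL gs]] := hg _ e4; exists s; split => //.
have -> : (fun x => f x - trig s x) = (fun x => (f x - g x) + (g x - trig s x)).
  by apply/funext => x; rewrite addrA subrK.
apply: sqnormD_lt => //; first exact: cmeasurableB.
by apply: cmeasurableB => //; exact: cmeasurable_trig.
Qed.

Lemma trig_limitD (L : set R) f g : trig_limit L f -> trig_limit L g ->
  trig_limit L (fun x => f x + g x).
Proof.
move=> [mf hf] [mg hg]; split=> [|eps e0]; first exact: cmeasurableD.
have e4 : 0 < eps / 4 by rewrite divr_gt0.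
have [s [sL hs]] := hf _ e4; have [t [tL ht]] := hg _ e4; exists (s ++ t); split.
  by move=> p; rewrite mem_cat => /orP[]; [exact: sL | exact: tL].
have -> : (fun x => f x + g x - trig (s ++ t) x) =
  (fun x => (f x - trig s x) + (g x - trig t x)).
  by apply/funext => x; rewrite trig_cat opprD addrACA.
by apply: sqnormD_lt => //; apply: cmeasurableB => //; exact: cmeasurable_trig.
Qed.

Lemma sqnorm_mul_le (f g h : RR -> C) (K : R) : cmeasurable f -> cmeasurable g ->
  cmeasurable h -> 0 <= K -> (forall x, nsq (h x) <= K) ->
  (sqnorm mu (fun x => h x * (f x - g x))%R <= K%:E * sqnorm mu (fun x => f x - g x)%R)%E.
Proof.
move=> mf mg mh K0 hK; apply: sqnorm_le => //.
- by apply: cmeasurableM => //; exact: cmeasurableB.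
- exact: cmeasurableB.
- by move=> x; rewrite nsqM ler_wpM2r ?nsq_ge0.
Qed.

Lemma sqnorm_mul_lt (f g h : RR -> C) (K eps : R) : cmeasurable f -> cmeasurable g ->
  cmeasurable h -> (forall x, nsq (h x) <= K) ->
  (sqnorm mu (fun x => f x - g x)%R < (eps / (K + 1))%:E)%E ->
  (sqnorm mu (fun x => h x * (f x - g x))%R < eps%:E)%E.
Proof.
move=> mf mg mh hK hfg.
have K0 : 0 <= K by apply: le_trans (hK 0); exact: nsq_ge0.
have K1 : 0 < K + 1 by rewrite ltr_wpDl.
apply: le_lt_trans (sqnorm_mul_le (K := K + 1) mf mg mh (ltW K1) _) _.
  by move=> x; rewrite (le_trans (hK x))// lerDl.
have -> : eps = (K + 1) * (eps / (K + 1)) by rewrite mulrCA divff ?mulr1// gt_eqF.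
by rewrite EFinM lte_pmul2l// lte_fin.
Qed.

Lemma trig_limitZ (L : set R) (c : C) f : trig_limit L f ->
  trig_limit L (fun x => c * f x).
Proof.
move=> [mf hf]; split=> [|eps e0].
  by apply: cmeasurableM => //; exact: cmeasurable_cst.
have [s [sL hs]] := hf _ (divr_gt0 e0 (ltr_wpDl (nsq_ge0 c) ltr01)).
exists [seq (c * p.1, p.2) | p <- s]; split.
  by move=> _ /mapP[p ps ->]; exact: (sL _ ps).
have -> : (fun x => c * f x - trig [seq (c * p.1, p.2) | p <- s] x) =
   (fun x => c * (f x - trig s x)).
  by apply/funext => x; rewrite trig_scale mulrBr.
apply: (@sqnorm_mul_lt _ _ (fun=> c) (nsq c)) => //; first exact: cmeasurable_trig.
Qed.

Lemma trig_limitMtrig s f : trig_limit setT f -> trig_limit setT (fun x => trig s x * f x).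
Proof.
move=> [mf hf]; split=> [|eps e0].
  by apply: cmeasurableM => //; exact: cmeasurable_trig.
have [K K0 hK] := trig_bounded s.
have [t [_ ht]] := hf _ (divr_gt0 e0 (ltr_wpDl K0 ltr01)).
exists (allpairs (fun p q => (p.1 * q.1, p.2 + q.2)) s t); split => //.
have -> : (fun x => trig s x * f x - trig [seq (p.1 * q.1, p.2 + q.2) | p <- s, q <- t] x) =
   (fun x => trig s x * (f x - trig t x)).
  by apply/funext => x; rewrite trig_mul mulrBr.
by apply: (@sqnorm_mul_lt _ _ (trig s) K) => //; exact: cmeasurable_trig.
Qed.

(** Bounded limits form an algebra: a good trigonometric approximation p of g
    makes f * p a good approximation of f * g because f is bounded, and f * p is a
    limit because p is bounded. *)
Lemma trig_limitM f g (K : R) : (forall x, nsq (f x) <= K) ->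
  trig_limit setT f -> trig_limit setT g -> trig_limit setT (fun x => f x * g x).
Proof.
move=> hK hf [mg hg]; have [mf _] := hf.
apply: trig_limit_closed => [|eps e0]; first exact: cmeasurableM.
have K0 : 0 <= K by apply: le_trans (hK 0); exact: nsq_ge0.
have [t [_ ht]] := hg _ (divr_gt0 e0 (ltr_wpDl K0 ltr01)).
exists (fun x => trig t x * f x); first exact: trig_limitMtrig.
have -> : (fun x => f x * g x - trig t x * f x) = (fun x => f x * (g x - trig t x)).
  by apply/funext => x; rewrite mulrBr [trig t x * _]mulrC.
by apply: (@sqnorm_mul_lt _ _ f K) => //; exact: cmeasurable_trig.
Qed.

Lemma trig1 (c : C) (l : R) x : trig [:: (c, l)] x = c * e (- (l * x)).
Proof. by rewrite /trig big_seq1 expo_e. Qed.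

Lemma trig_limit_cst (c : C) : trig_limit setT (fun=> c).
Proof.
have -> : (fun=> c) = trig [:: (c, 0)].
  by apply/funext => x; rewrite trig1 mul0r oppr0 e0 mulr1.
exact: trig_limit_trig.
Qed.

(** Dominated convergence. *)
Lemma trig_limit_cvg (f_ : nat -> RR -> C) (f : RR -> C) (G : RR -> R) :
  (forall n, trig_limit setT (f_ n)) -> (forall x, ccvg (f_ ^~ x) (f x)) ->
  mu.-integrable setT (EFin \o G) -> (forall n x, nsq (f x - f_ n x) <= G x) ->
  trig_limit setT f.
Proof.
move=> hf_ hc iG hG.
have mf : cmeasurable f.
  split; [apply: (@measurable_fun_cvg _ _ _ _ (fun n x => complex.Re (f_ n x)))
         |apply: (@measurable_fun_cvg _ _ _ _ (fun n x => complex.Im (f_ n x)))].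
  - by move=> n; case: (hf_ n) => -[].
  - by move=> x _; case: (hc x).
  - by move=> n; case: (hf_ n) => -[].
  - by move=> x _; case: (hc x).
apply: trig_limit_closed => // eps e0.
have cv : (sqnorm mu (fun x => f x - f_ n x)%R @[n --> \oo] --> 0)%E.
  rewrite -(@integral0 _ _ _ mu setT).
  apply: (@dominated_cvg _ _ _ mu setT measurableT _ _ (EFin \o G)) => //.
  - by move=> n; apply: measurable_nsqE; apply: cmeasurableB => //; case: (hf_ n).
  - move=> x _; apply: cvg_EFin; first exact: nearW.
    have := ccvg_nsq (ccvgD (ccvg_cst (f x)) (ccvgM (ccvg_cst (-1)) (hc x))).
    rewrite mulN1r subrr nsq0; apply: cvg_trans.
    by apply: near_eq_cvg; apply: nearW => n /=; rewrite mulN1r.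
  - by move=> n x _; rewrite /= ger0_norm ?nsq_ge0// lee_fin.
have [n _ hn] : \forall n \near \oo, (sqnorm mu (fun x => f x - f_ n x)%R < eps%:E)%E.
  have [cf cr] := (fine_cvgP _ _).1 cv.
  near=> n; have nf : sqnorm mu (fun x => f x - f_ n x)%R \is a fin_num by near: n.
  rewrite -(fineK nf) lte_fin.
  by near: n; apply: (cvgr_lt _ cr).
by exists (f_ n) => //; exact: (hn n (leqnn n)).
Unshelve. all: by end_near.
Qed.

Lemma integrable_cst (K : R) : mu.-integrable setT (EFin \o (fun=> K)).
Proof. exact: (@bounded_integrable _ mu (fun=> K) `|K|). Qed.

End TrigPolynomials.

(** * Density of the trigonometric polynomials *)

Section Density.
Context {R : realType}.
Local Notation RR := (measurableTypeR R).
Local Notation C := R[i].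
Variable mu : {finite_measure set RR -> \bar R}.

(** The real functions in the closure of all trigonometric polynomials. *)
Definition rlim (f : RR -> R) : Prop := trig_limit mu setT (fun x => (f x)%:C%C).

Lemma nsq_real (a : R) : nsq (a%:C%C) = a ^+ 2.
Proof. by rewrite /nsq /= expr0n addr0. Qed.

Lemma rlimD f g : rlim f -> rlim g -> rlim (fun x => f x + g x).
Proof.
move=> hf hg; have := trig_limitD hf hg; congr trig_limit.
by apply/funext => x; rewrite rmorphD.
Qed.

Lemma rlim_cst (a : R) : rlim (fun=> a).
Proof. exact: trig_limit_cst. Qed.

Lemma rlimM (K : R) f g : (forall x, `|f x| <= K) -> rlim f -> rlim g ->
  rlim (fun x => f x * g x).
Proof.
move=> fK hf hg; have : trig_limit mu setT (fun x => (f x)%:C%C * (g x)%:C%C).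
  apply: (@trig_limitM _ _ _ _ (K ^+ 2)) => // x.
  by rewrite nsq_real -real_normK ?num_real// lerXn2r ?nnegrE// (le_trans _ (fK x)).
by congr trig_limit; apply/funext => x; rewrite rmorphM.
Qed.

Lemma rlimZ (a : R) f : rlim f -> rlim (fun x => a * f x).
Proof. by move=> hf; apply: (@rlimM `|a|) => //; exact: rlim_cst. Qed.

Lemma rlimB f g : rlim f -> rlim g -> rlim (fun x => f x - g x).
Proof.
move=> hf hg; have := rlimD hf (rlimZ (-1) hg); congr rlim.
by apply/funext => x; rewrite mulN1r.
Qed.

Lemma rlim_cvg (f_ : nat -> RR -> R) (f : RR -> R) (G : RR -> R) :
  (forall n, rlim (f_ n)) -> (forall x, f_ n x @[n --> \oo] --> f x) ->
  mu.-integrable setT (EFin \o G) -> (forall n x, (f x - f_ n x) ^+ 2 <= G x) ->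
  rlim f.
Proof.
move=> h1 h2 iG hG; apply: (trig_limit_cvg h1 _ iG).
- by move=> x; split => //=; exact: cvg_cst.
- by move=> n x; rewrite -rmorphB nsq_real.
Qed.

Lemma rlim_Re_trig s : rlim (fun x => complex.Re (trig s x)).
Proof.
have : trig_limit mu setT (trig ([seq (2%:R^-1 * p.1, p.2) | p <- s] ++
   [seq (2%:R^-1 * p.1, p.2) | p <- [seq (conjc p.1, - p.2) | p <- s]])).
  exact: trig_limit_trig.
congr trig_limit; apply/funext => x.
by rewrite trig_cat !trig_scale trig_conj -mulrDr mulrC ReJ_add.
Qed.

(** The smoothstep polynomial: it fixes 0, 1/2 and 1, attracts [0, 1/2[ to 0 and
    ]1/2, 1] to 1. Its iterates turn a function u with values in [0, 1] into the
    indicator of {u > 1/2} by polynomial means. *)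
Definition smooth (y : R) : R := y ^+ 2 * (3 - 2 * y).

Lemma smooth01 y : 0 <= y <= 1 -> 0 <= smooth y <= 1.
Proof.
move=> /andP[y0 y1]; rewrite /smooth; apply/andP; split.
  by apply: mulr_ge0; [exact: sqr_ge0|lra].
rewrite -subr_ge0; have -> : 1 - y ^+ 2 * (3 - 2 * y) = (1 - y) ^+ 2 * (1 + 2 * y).
  by ring.
by apply: mulr_ge0; [exact: sqr_ge0|lra].
Qed.

Lemma iter_smooth01 n y : 0 <= y <= 1 -> 0 <= iter n smooth y <= 1.
Proof. by move=> h; elim: n => //= n; exact: smooth01. Qed.

(** Below 1/2 the ratio smooth z / z = z (3 - 2z) increases with z and stays
    below 1, so that the iterates decrease geometrically. *)
Lemma cvg_iter_smooth_lt y : 0 <= y < 2^-1 -> iter n smooth y @[n --> \oo] --> (0 : R).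
Proof.
move=> /andP[y0 y2]; pose r := y * (3 - 2 * y).
have r0 : 0 <= r by rewrite /r; apply: mulr_ge0; lra.
have r1 : r < 1.
  rewrite -subr_gt0 (_ : 1 - r = (1 - y) * (1 - 2 * y)); last by rewrite /r; ring.
  by apply: mulr_gt0; lra.
have key n : 0 <= iter n smooth y <= r ^+ n * y.
  elim: n => [|n /andP[h1 h2]]; first by rewrite expr0 mul1r y0 lexx.
  have h3 : iter n smooth y <= y.
    by apply: le_trans h2 _; rewrite ler_piMl// exprn_ile1// ltW.
  rewrite /= /smooth; set z := iter n smooth y in h1 h2 h3 *.
  apply/andP; split; first by apply: mulr_ge0; [exact: sqr_ge0|lra].
  have hz : z * (3 - 2 * z) <= r.
    rewrite -subr_ge0 (_ : r - _ = (y - z) * (3 - 2 * (y + z))).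
      by apply: mulr_ge0; lra.
    by rewrite /r; ring.
  rewrite expr2 -mulrA (_ : r ^+ n.+1 * y = r ^+ n * y * r); last first.
    by rewrite exprSr mulrAC.
  by apply: le_trans (ler_wpM2l h1 hz) _; exact: ler_wpM2r.
apply: (@squeeze_cvgr _ _ _ _ (fun=> 0) (fun n => r ^+ n * y)).
- by apply: nearW => n; exact: key.
- exact: cvg_cst.
- rewrite -[0](mul0r y); apply: cvgM; last exact: cvg_cst.
  apply: cvg_expr.
  by rewrite ger0_norm.
Qed.

Lemma smoothC y : smooth (1 - y) = 1 - smooth y.
Proof. by rewrite /smooth; ring. Qed.

Lemma cvg_iter_smooth_gt y : 2^-1 < y <= 1 -> iter n smooth y @[n --> \oo] --> (1 : R).
Proof.
move=> /andP[y2 y1].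
have h n : iter n smooth y = 1 - iter n smooth (1 - y).
  by elim: n => [|n IH] /=; [ring | rewrite IH smoothC].
under eq_fun do rewrite h.
have y3 : 0 <= 1 - y < 2^-1 by lra.
have c := cvgB (cvg_cst (1 : R)) (cvg_iter_smooth_lt y3).
by rewrite subr0 in c; exact: c.
Qed.

Lemma iter_smooth_half n : iter n smooth 2^-1 = 2^-1.
Proof. by elim: n => //= n ->; rewrite /smooth; field. Qed.

(** The pointwise limit of the iterates of smooth. *)
Definition half_step (y : R) : R := if y < 2^-1 then 0 else if y == 2^-1 then 2^-1 else 1.

Lemma cvg_iter_smooth y : 0 <= y <= 1 -> iter n smooth y @[n --> \oo] --> half_step y.
Proof.
move=> /andP[y0 y1]; rewrite /half_step; case: ltP => h.
  by apply: cvg_iter_smooth_lt; rewrite y0.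
case: eqP => [->|/eqP ne].
  by under eq_fun do rewrite iter_smooth_half; exact: cvg_cst.
by apply: cvg_iter_smooth_gt; rewrite y1 lt_def ne h.
Qed.

Lemma half_step01 y : 0 <= half_step y <= 1.
Proof. by rewrite /half_step; case: ifP => _; [|case: ifP => _]; lra. Qed.

Lemma sqr_dist01 (a b : R) : 0 <= a <= 1 -> 0 <= b <= 1 -> (a - b) ^+ 2 <= 1.
Proof. by move=> ha hb; nra. Qed.

Lemma norm01 (a : R) : 0 <= a <= 1 -> `|a| <= 1.
Proof. by case/andP => a0 a1; rewrite ger0_norm. Qed.

Lemma rlim_half_step (u : RR -> R) : (forall x, 0 <= u x <= 1) -> rlim u ->
  rlim (fun x => half_step (u x)).
Proof.
move=> u01 hu; apply: (@rlim_cvg (fun n x => iter n smooth (u x)) _ (fun=> 1)).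
- elim=> [//|n IH] /=; rewrite /smooth.
  have b x : `|iter n smooth (u x)| <= 1 by apply: norm01; exact: iter_smooth01.
  apply: (@rlimM 1).
  + by move=> x; rewrite normrX exprn_ile1.
  + by under eq_fun do rewrite expr2; apply: (@rlimM 1).
  + by apply: rlimB; [exact: rlim_cst | exact: rlimZ].
- by move=> x; exact: cvg_iter_smooth.
- exact: integrable_cst.
- by move=> n x; apply: sqr_dist01; [exact: half_step01 | exact: iter_smooth01].
Qed.

(** Above 1/2 on the half period on the right of a, below on the left. *)
Definition wave (a T : R) (x : RR) : R := (1 + sin (2 * pi * ((x - a) / T))) / 2.

Lemma wave01 a T x : 0 <= wave a T x <= 1.
Proof.
rewrite /wave; have := sin_geN1 (2 * pi * ((x - a) / T)).
by have := sin_le1 (2 * pi * ((x - a) / T)); lra.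
Qed.

Lemma rlim_wave a T : rlim (wave a T).
Proof.
have -> : wave a T = fun x => 2^-1 * (1 +
    complex.Re (trig [:: (e (- (a / T) - 4^-1), - T^-1)] x)).
  apply/funext => x; rewrite /wave mulrC trig1 -eD.
  rewrite (_ : _ + - (- T^-1 * x) = (x - a) / T - 4^-1); last by rewrite mulNr opprK; ring.
  rewrite /e /= mulrBr (_ : 2 * pi * 4^-1 = pi / 2); last by field.
  by rewrite cosBpihalf.
by apply: rlimZ; apply: rlimD; [exact: rlim_cst | exact: rlim_Re_trig].
Qed.

(** The indicator of ]a, +oo[, with the value 1/2 at a that it inherits from the
    fixed point of smooth. *)
Definition half_ray (a : R) (x : RR) : R := if x < a then 0 else if x == a then 2^-1 else 1.

(** As the period grows, a half period of the wave fills up each side of a. *)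
Lemma rlim_half_ray a : rlim (half_ray a).
Proof.
apply: (@rlim_cvg (fun n x => half_step (wave a (2 * n.+1%:R) x)) _ (fun=> 1)).
- by move=> n; apply: rlim_half_step; [exact: wave01 | exact: rlim_wave].
- move=> x; have [m hm] : exists m : nat, `|x - a| < m%:R.
    exists (Num.truncn `|x - a|).+1.
    by have /truncn_itv/andP[] : 0 <= `|x - a| by [].
  suff hs n : (m <= n)%N -> half_step (wave a (2 * n.+1%:R) x) = half_ray a x.
    apply: (@cvg_trans _ (half_ray a x @[n --> \oo])); last exact: cvg_cst.
    by apply: near_eq_cvg; exists m => // n /= mn; rewrite hs.
  move=> mn; set t := (x - a) / (2 * n.+1%:R).
  have n0 : (0 : R) < 2 * n.+1%:R by rewrite mulr_gt0// ltr0n.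
  have ht : `|t| < 2^-1.
    rewrite /t normrM normfV (gtr0_norm n0) ltr_pdivrMr// mulrA mulVf ?mul1r//.
    by rewrite (lt_le_trans hm)// ler_nat leqW.
  have sg (y : R) : 0 < y < 2^-1 -> 0 < sin (2 * pi * y).
    move=> /andP[y0 y1]; apply: sin_gt0_pi; have := pi_gt0 R => p0.
    by rewrite !mulr_gt0//= mulrAC gtr_pMl//; lra.
  rewrite /half_step /half_ray /wave -/t; have [xa|xa|xa] := ltgtP x a.
  + have : 0 < sin (2 * pi * (- t)).
      apply: sg; apply/andP; split.
        by rewrite oppr_gt0 /t pmulr_llt0 ?invr_gt0// subr_lt0.
      by apply: le_lt_trans (ler_norm _) _; rewrite normrN.
    by rewrite mulrN sinN => ?; rewrite ifT//; lra.
  + have : 0 < sin (2 * pi * t).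
      apply: sg; apply/andP; split; first by rewrite /t divr_gt0// subr_gt0.
      exact: le_lt_trans (ler_norm _) ht.
    by move=> ?; case: ltgtP => //; lra.
  + rewrite /t xa subrr mul0r mulr0 sin0 addr0 mul1r ltxx eqxx.
    by [].
- exact: integrable_cst.
- move=> n x; apply: sqr_dist01; last exact: half_step01.
  by rewrite /half_ray; case: ifP => _; [|case: ifP => _]; lra.
Qed.

(** The polynomial 2 y^2 - y fixes 0 and 1 and sends the value 1/2 at a to 0. *)
Lemma rlim_ray (a : R) : rlim (\1_(`]a, +oo[%classic) : RR -> R).
Proof.
have b x : `|half_ray a x| <= 1.
  by apply: norm01; rewrite /half_ray; case: ifP => _; [|case: ifP => _]; lra.
have := rlimB (rlimZ 2 (rlimM b (rlim_half_ray a) (rlim_half_ray a))) (rlim_half_ray a).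
congr rlim; apply/funext => x; rewrite indicE mem_setE in_itv /= andbT /half_ray.
by case: ltgtP => _ /=; lra.
Qed.

Lemma rlim_indicC (A : set RR) : rlim (\1_A : RR -> R) -> rlim (\1_(~` A) : RR -> R).
Proof.
move=> hA; have := rlimB (rlim_cst 1) hA; congr rlim; apply/funext => x.
rewrite !indicE in_setC; case: (x \in A) => /=; first by rewrite subrr.
by rewrite subr0.
Qed.

Lemma norm_indic_le1 (A : set RR) x : `|\1_A x : R| <= 1.
Proof. by rewrite indicE; case: (x \in A); rewrite ?normr1 ?normr0. Qed.

Lemma rlim_indicU (A B : set RR) : rlim (\1_A : RR -> R) -> rlim (\1_B : RR -> R) ->
  rlim (\1_(A `|` B) : RR -> R).
Proof.
move=> hA hB; have := rlimM (norm_indic_le1 _) (rlim_indicC hA) (rlim_indicC hB).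
move=> /(rlimB (rlim_cst 1)); congr rlim; apply/funext => x.
rewrite !indicE in_setU !in_setC.
by case: (x \in A); case: (x \in B) => /=; rewrite ?mulr0n ?mulr1n; ring.
Qed.

(** The sets whose indicators are limits form a sigma-algebra, since bounded limits
    form an algebra closed under bounded pointwise convergence; it contains the
    rays. *)
Lemma rlim_indic (A : set RR) : measurable A -> rlim (\1_A : RR -> R).
Proof.
have -> : (measurable : set (set RR)) = (@RGenOInfty.G R).-sigma.-measurable.
  exact: RGenOInfty.measurableE.
suff : <<s @RGenOInfty.G R >> `<=` [set B : set RR | rlim (\1_B : RR -> R)] by apply.
apply: smallest_sub.
  split => /=.
  - by have := rlim_cst 0; congr rlim; apply/funext => x; rewrite indic0.
  - by move=> B hB; rewrite setTD; exact: rlim_indicC.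
  - move=> F hF; apply: (@rlim_cvg (fun n => \1_(\bigcup_(k < n) F k)) _ (fun=> 1)).
    + elim=> [|n IH]; first by rewrite bigcup_mkord big_ord0 indic0; exact: rlim_cst.
      by rewrite bigcup_mkord big_ord_recr -bigcup_mkord; exact: rlim_indicU.
    + move=> x; have [[m _ Fm]|nF] := pselect ((\bigcup_k F k) x).
        apply: (@cvg_trans _ (\1_(\bigcup_k F k) x @[n --> \oo])); last exact: cvg_cst.
        apply: near_eq_cvg; exists m.+1 => // n /= mn; rewrite !indicE !mem_set//.
          by exists m.
        by exists m.
      apply: (@cvg_trans _ (\1_(\bigcup_k F k) x @[n --> \oo])); last exact: cvg_cst.
      apply: near_eq_cvg; apply: nearW => n; rewrite !indicE !memNset//.
      by move=> [k _ Fk]; apply: nF; exists k.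
    + exact: integrable_cst.
    + by move=> n x; apply: sqr_dist01; rewrite indicE; case: (_ \in _); rewrite ?lexx ?ler01.
by move=> B [a ->]; exact: rlim_ray.
Qed.

Lemma rlim_sum (I : Type) (s : seq I) (f : I -> RR -> R) : (forall i, rlim (f i)) ->
  rlim (fun x => \sum_(i <- s) f i x).
Proof.
move=> hf; elim: s => [|a s IH].
  by under eq_fun do rewrite big_nil; exact: rlim_cst.
by under eq_fun do rewrite big_cons; exact: rlimD.
Qed.

(** Simple functions from below, with f^2 itself dominating the squared errors. *)
Lemma rlim_nonneg (f G : RR -> R) : measurable_fun [set: RR] f -> (forall x, 0 <= f x) ->
  mu.-integrable setT (EFin \o G) -> (forall x, f x ^+ 2 <= G x) -> rlim f.
Proof.
move=> mf f0 iG fG; have mf' : measurable_fun [set: RR] (EFin \o f) by exact/measurable_EFinP.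
have f0' x : [set: RR] x -> (0 <= (EFin \o f) x)%E by rewrite lee_fin.
apply: (@rlim_cvg (fun n x => nnsfun_approx measurableT mf' n x) f G) => //.
- move=> n; set g := nnsfun_approx _ _ _.
  have -> : (g : RR -> R) = fun x => \sum_(i < #|` fset_set (range g)|)
     (fset_set (range g))`_i * \1_(g @^-1` [set (fset_set (range g))`_i]) x.
    by apply/funext => x; rewrite fimfunEord.
  by apply: rlim_sum => i; apply: rlimZ; apply: rlim_indic; exact: measurable_funPTI.
- move=> x; have := @cvg_approx _ _ _ setT (EFin \o f) x f0' I (ltry _).
  by apply: cvg_trans; apply: near_eq_cvg; apply: nearW => n; rewrite nnsfun_approxE.
- move=> n x; apply: le_trans (fG x); rewrite nnsfun_approxE.
  have := @le_approx _ _ _ setT (EFin \o f) n x f0' I; rewrite lee_fin => h.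
  have h0 : 0 <= approx setT (EFin \o f) n x.
    by rewrite -(nnsfun_approxE measurableT mf').
  by rewrite lerXn2r ?nnegrE ?subr_ge0// lerBlDr lerDl.
Qed.

(** The trigonometric polynomials are dense in L^2 of a finite Borel measure. *)
Theorem trig_dense (f : RR -> C) : cmeasurable f -> (sqnorm mu f < +oo)%E -> trig_limit mu setT f.
Proof.
move=> [mr mi] hf.
have iG : mu.-integrable setT (EFin \o (fun x => nsq (f x))).
  apply/integrableP; split; first exact: measurable_nsqE.
  by under eq_integral do rewrite gee0_abs ?lee_fin ?nsq_ge0//.
(* Positive and negative parts of a real function dominated by f. *)
have real_case (g : RR -> R) : measurable_fun [set: RR] g ->
    (forall x, g x ^+ 2 <= nsq (f x)) -> rlim g.
  move=> mg gf.
  have h (s : R) : s ^+ 2 = 1 -> rlim (fun x => Num.max (s * g x) 0).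
    move=> s2; apply: (@rlim_nonneg _ (fun x => nsq (f x))) => //.
    - by apply: measurable_maxr => //; exact: measurable_funM.
    - by move=> x; rewrite le_max lexx orbT.
    - move=> x; rewrite /Num.max; case: ifP => _; first by rewrite expr0n nsq_ge0.
      by rewrite exprMn s2 mul1r.
  have := rlimB (h 1 (expr1n _ _)) (h (-1) (etrans (sqrrN 1) (expr1n _ _))).
  congr rlim; apply/funext => x; rewrite mul1r mulN1r.
  by case: (leP (g x) 0); case: (leP (- g x) 0); lra.
have hr : rlim (fun x => complex.Re (f x)).
  by apply: real_case => // x; rewrite lerDl sqr_ge0.
have hi : rlim (fun x => complex.Im (f x)).
  by apply: real_case => // x; rewrite lerDr sqr_ge0.
have := trig_limitD hr (trig_limitZ 'i%C hi); congr trig_limit.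
by apply/funext => x; rewrite -complexE.
Qed.

End Density.

(** * Spectral measures and Parseval's identity *)

Section Parseval.
Context {R : realType}.
Local Notation RR := (measurableTypeR R).
Local Notation C := R[i].
Variable mu : probability RR R.

Lemma fourier0 : fourier mu 0 = 1.
Proof.
rewrite /fourier /cintegral; congr Complex.
- rewrite (@eq_Rintegral _ _ _ _ _ (fun=> 1)) => [|x _]; last by rewrite /= mulr0 mul0r oppr0 cos0.
  by rewrite Rintegral_cst// mul1r -[RHS]/(fine 1%E); congr fine; exact: probability_setT.
- rewrite (@eq_Rintegral _ _ _ _ _ (fun=> 0)) => [|x _]; last by rewrite /= mulr0 mul0r oppr0 sin0.
  by rewrite Rintegral_cst// mul0r.
Qed.

Lemma cinner_expo (l m : R) : cinner mu (expo l) (expo m) = fourier mu (l - m).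
Proof.
by congr cintegral; apply/funext => x; rewrite expo_conj expoD.
Qed.

(** This identifies the form of the transform of mu with the norm of L^2(mu). *)
Lemma sqnorm_trig s : sqnorm mu (trig s) = (qform (fourier mu) s)%:E.
Proof.
have E x : nsq (trig s x) = complex.Re
    (\sum_(p <- s) \sum_(q <- s) p.1 * conjc q.1 * expo (p.2 - q.2) x).
  rewrite -[LHS]/(complex.Re (nsq (trig s x))%:C%C) nsqE -trig_conj -trig_mul /trig.
  congr complex.Re; rewrite big_allpairs_dep; apply: eq_bigr => p _.
  by rewrite big_map.
have icint p q : cintegrable mu (fun x => p.1 * conjc q.1 * expo (p.2 - q.2) x : C).
  by apply: cintegrableZ; exact: cintegrable_expo.
rewrite /sqnorm; under eq_integral do rewrite E.
have [h _] := cintegrable_sum s (fun p => cintegrable_sum s (icint p)).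
rewrite -[LHS]fineK; last exact: integrable_fin_num.
congr EFin; rewrite -[LHS]/(complex.Re (cintegral mu _)).
rewrite cintegral_sum => [|p]; last exact: cintegrable_sum.
rewrite /qform; congr complex.Re; apply: eq_bigr => p _.
rewrite cintegral_sum => [|q]; last exact: icint.
by apply: eq_bigr => q _; rewrite cintegralZ//; exact: cintegrable_expo.
Qed.

Lemma sqnorm_expo l : (sqnorm mu (expo l) < +oo)%E.
Proof.
rewrite /sqnorm (eq_integral (cst 1%E)) => [|x _]; last by rewrite expo_e nsq_e.
rewrite integral_cst// mul1e ltey_eq; apply/orP; left.
exact: (@fin_num_measure _ _ _ mu).
Qed.

(** Frequencies repeated in s are merged: a spectrum is tested against combinations
    indexed by finite sets. *)
Lemma trig_fset (s : seq (C * R)) : exists (F : {fset R}) (c : R -> C),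
  {subset F <= [seq p.2 | p <- s]} /\
  forall x, trig s x = \sum_(l <- F) c l * expo l x.
Proof.
exists [fset l in [seq p.2 | p <- s]]%fset, (fun l => \sum_(p <- s | p.2 == l) p.1).
split=> [l|x]; first by rewrite !inE.
set F := [fset l in _]%fset.
under [RHS]eq_bigr do rewrite mulr_suml.
rewrite [RHS](exchange_big_dep xpredT)//= /trig; apply: eq_big_seq => p ps.
have pF : p.2 \in F by rewrite !inE map_f.
rewrite (big_rem p.2)//= eqxx big1_seq ?addr0// => l /andP[/eqP <-].
by rewrite mem_rem_uniqF ?fset_uniq.
Qed.

Definition orthogonal_spectrum (phi : R -> C) (L : set R) : Prop :=
  forall l m, L l -> L m -> l != m -> phi (l - m) = 0.

(** The inequality that is missing in Bessel's, for the exponential of frequency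
    xi. Finite sums and an error term stand for the sum over L. *)
Definition parseval_at (phi : R -> C) (L : set R) (xi : R) : Prop :=
  forall eps : R, 0 < eps -> exists F : seq R, [/\ uniq F, {in F, forall x, L x} &
    1 - eps < \sum_(x <- F) nsq (phi (xi - x))].

Lemma sqnorm_proj_error (L : set R) xi (F : seq R) c :
  orthogonal_spectrum (fourier mu) L -> uniq F -> {in F, forall x, L x} ->
  sqnorm mu (fun x => expo xi x - \sum_(l <- F) c l * expo l x) =
  (1 - \sum_(x <- F) nsq (fourier mu (xi - x)) +
    \sum_(x <- F) nsq (c x - fourier mu (xi - x)))%:E.
Proof.
move=> oL uF FL; rewrite -(qform_proj_error c fourier0 uF) => [|x xF|x y xF yF xy].
- rewrite -sqnorm_trig; congr sqnorm; apply/funext => x.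
  rewrite /trig /proj_error big_cons big_map mul1r -sumrN; congr (_ + _).
  by apply: eq_bigr => l _; rewrite mulNr.
- by rewrite fourier_conj opprB.
- by rewrite oL//; exact: FL.
Qed.

(** The squared distance of the exponential of frequency xi to a finite part of the
    orthonormal family is the Parseval defect at xi; so Parseval at every xi puts
    all exponentials in the closed span, and exponentials span L^2(mu). *)
Theorem spectral_parseval : spectral_measure mu <->
  exists L : set R, [/\ countable L, orthogonal_spectrum (fourier mu) L &
    forall xi, parseval_at (fourier mu) L xi].
Proof.
split=> [[L [cL [[inL orthL] totL]]]|[L [cL oL pL]]].
  have oL : orthogonal_spectrum (fourier mu) L.
    by move=> l m Ll Lm /negbTE lm; rewrite -cinner_expo orthL// lm.
  exists L; split => // xi eps e0.
  have in_xi : in_cL2 mu (expo xi).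
    have [m1 m2] := measurable_expo xi; split => //.
    by apply/cLnorm2_lty; exact: sqnorm_expo.
  (* Chosen so that d ^+ 2 < eps. *)
  pose d := Num.min 1 (eps / 2).
  have d0 : 0 < d by rewrite lt_min ltr01 divr_gt0.
  have [F [c [FL hF]]] := totL _ in_xi d d0.
  have FL' : {in F, forall x, L x} by move=> x xF; exact: FL.
  exists F; split; [exact: fset_uniq | exact: FL' | ].
  have := sqnorm_of_cLnorm2 hF.
  rewrite (sqnorm_proj_error _ _ oL (fset_uniq F) FL').
  rewrite lee_fin => h.
  have h2 : 0 <= \sum_(x <- F) nsq (c x - fourier mu (xi - x)).
    by apply: sumr_ge0 => x _; exact: nsq_ge0.
  have h3 : d ^+ 2 < eps.
    have d1 : d <= 1 by rewrite ge_min lexx.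
    have d2 : d <= eps / 2 by rewrite ge_min lexx orbT.
    by apply: (@le_lt_trans _ _ d); [rewrite expr2 ler_piMl// ltW | lra].
  by lra.
exists L; split => //; split.
  split=> [l Ll|l m Ll Lm].
    have [m1 m2] := measurable_expo l; split => //.
    by apply/cLnorm2_lty; exact: sqnorm_expo.
  rewrite cinner_expo; have [->|lm] := eqVneq l m; first by rewrite subrr fourier0.
  by rewrite oL.
move=> f [mr mi hf] eps e0.
have lim_e xi : trig_limit mu L (expo xi).
  split=> [|d d0]; first exact: cmeasurable_expo.
  have [F [uF FL hF]] := pL xi _ d0.
  exists [seq (fourier mu (xi - x), x) | x <- F]; split.
    by move=> _ /mapP[x xF ->]; exact: (FL _ xF).
  under [X in sqnorm mu X]eq_fun do rewrite /trig big_map /=.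
  rewrite (sqnorm_proj_error _ _ oL)// [X in _ + X]big1 => [|x _]; last first.
    by rewrite subrr nsq0.
  by rewrite addr0 lte_fin; lra.
have lim_trig s : trig_limit mu L (trig s).
  elim: s => [|p s IH].
    by apply: trig_limit_trig.
  have -> : trig (p :: s) = fun x => p.1 * expo p.2 x + trig s x.
    by apply/funext => x; rewrite /trig big_cons.
  by apply: trig_limitD => //; exact: trig_limitZ.
have mf : cmeasurable f by [].
have [_ /(_ _ (exprn_gt0 2 e0))[s [sL hs]]] : trig_limit mu L f.
  apply: trig_limit_closed => // d d0.
  have [_ /(_ _ d0)[s [_ hs]]] := trig_dense mf (proj1 (cLnorm2_lty _ _) hf).
  by exists (trig s).
have [F [c [Fs Ec]]] := trig_fset s; exists F, c; split.
  by move=> x /Fs/mapP[p ps ->]; exact: sL.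
apply: cLnorm2_lt => //; congr (sqnorm mu _ < _)%E: hs.
by apply/funext => x; rewrite Ec.
Qed.

End Parseval.

(** * Selecting one class per label *)

Section Selection.
Context {R : realType}.

Lemma sum_by_class (T : eqType) (D : eqType) (F : seq T) (c : T -> D) (E : seq D)
    (q : T -> R) : uniq E -> {in F, forall t, c t \in E} ->
  \sum_(t <- F) q t = \sum_(d <- E) \sum_(t <- F | c t == d) q t.
Proof.
move=> uE cE; rewrite (exchange_big_dep xpredT)//=; apply: eq_big_seq => t tF.
rewrite (big_rem (c t)) ?cE//= eqxx big1_seq ?addr0// => d /andP[/eqP <-].
by rewrite mem_rem_uniqF.
Qed.

(** Points t are sorted by a label c t and, for each label, into M classes h t,
    with weights w c i of sum 1. The weighted sum of q being 1 while the sum over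
    any selection of one class per label is at most 1, every selection has sum 1:
    for the selection b of the heaviest class of each label, the sum is at least
    the weighted sum, hence equality holds throughout, and as the weights are
    positive all classes of a label have the same sum.

    Infinitely many labels may occur and the weights need not be bounded below, so
    equality is approached in two stages: a finite F0 misses at most eps / 2 and
    meets finitely many labels, whose weights are at least some del > 0; then a
    larger finite set F, nearly full up to del * eps / 2, controls the gap between
    b and s on these labels. *)
Lemma selection_full_sum (T D : eqType) (M : nat) (c : T -> D) (h : T -> nat)
    (w : D -> nat -> R) (q : T -> R) (L : T -> Prop) :
  (0 < M)%N ->
  (forall t, (h t < M)%N) ->
  (forall t i, L t -> (i < M)%N -> 0 < w (c t) i) ->
  (forall d, \sum_(i < M) w d i = 1) ->
  (forall t, 0 <= q t) ->
  (forall eps : R, 0 < eps -> exists F : seq T, [/\ uniq F, {in F, forall t, L t} &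
     1 - eps < \sum_(t <- F) w (c t) (h t) * q t]) ->
  (forall s : D -> nat, (forall d, (s d < M)%N) -> forall F : seq T, uniq F ->
     {in F, forall t, L t} -> {in F, forall t, h t = s (c t)} -> \sum_(t <- F) q t <= 1) ->
  forall s : D -> nat, (forall d, (s d < M)%N) -> forall eps : R, 0 < eps ->
    exists F : seq T, [/\ uniq F, {in F, forall t, L t}, {in F, forall t, h t = s (c t)} &
     1 - eps < \sum_(t <- F) q t].
Proof.
move=> M0 hM w0 w1 q0 full bes s sM eps e0.
have e2 : 0 < eps / 2 by rewrite divr_gt0.
have [F0 [uF0 LF0 hF0]] := full _ e2.
pose E0 := undup (map c F0).
have cE0 t : t \in F0 -> c t \in E0 by move=> tF; rewrite mem_undup map_f.
have [del del0 hdel] : exists2 del : R, 0 < del & {in E0, forall d, del <= w d (s d)}.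
  have : {in E0, forall d, 0 < w d (s d)}.
    by move=> d; rewrite mem_undup => /mapP[t /LF0 Lt ->]; exact: w0.
  elim: E0 {cE0} => [_|d E IH hE]; first by exists 1.
  have [del del0 hd] := IH (fun x xE => hE x (mem_behead (s := d :: E) xE)).
  exists (Num.min del (w d (s d))); first by rewrite lt_min del0 hE ?mem_head.
  move=> x; rewrite inE => /orP[/eqP->|xE]; rewrite ge_min ?lexx ?orbT//.
  by rewrite hd.
have [F1 [uF1 LF1 hF1]] := full _ (mulr_gt0 del0 e2).
pose F := undup (F0 ++ F1).
have uF : uniq F by exact: undup_uniq.
have memF t : (t \in F) = (t \in F0) || (t \in F1) by rewrite mem_undup mem_cat.
have LF : {in F, forall t, L t}.
  by move=> t; rewrite memF => /orP[]; [exact: LF0 | exact: LF1].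
pose S d i := \sum_(t <- F | (c t == d) && (h t == i)) q t.
have S0 d i : 0 <= S d i by apply: sumr_ge0.
(* The heaviest class of each label. *)
pose b d : nat := [arg max_(i > Ordinal M0) S d i]%O.
have bM d : (b d < M)%N by exact: ltn_ord.
have bmax d i : (i < M)%N -> S d i <= S d (b d).
  rewrite /b => iM; case: arg_maxP => //= i0 _ /(_ (Ordinal iM) isT).
  by [].
have sum_class d : \sum_(t <- F | c t == d) w (c t) (h t) * q t =
    \sum_(i < M) w d i * S d i.
  rewrite (eq_bigr (fun t => \sum_(i < M | h t == i) w d i * q t)); last first.
    by move=> t /eqP <-; rewrite (big_pred1 (Ordinal (hM t))).
  rewrite (exchange_big_dep xpredT)//=; apply: eq_bigr => i _.
  by rewrite /S mulr_sumr.
pose E := undup (map c F).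
have uE : uniq E by exact: undup_uniq.
have cE t : t \in F -> c t \in E by move=> tF; rewrite mem_undup map_f.
have subE0E : {subset E0 <= E}.
  move=> d; rewrite !mem_undup => /mapP[t tF ->]; apply: map_f.
  by rewrite memF tF.
have sel (r : D -> nat) (A : seq D) : uniq A ->
    \sum_(t <- F | (c t \in A) && (h t == r (c t))) q t = \sum_(d <- A) S d (r d).
  move=> uA; rewrite -big_filter (@sum_by_class _ _ _ c A)//; last first.
    by move=> t; rewrite mem_filter => /andP[/andP[]].
  apply: eq_big_seq => d dA; rewrite /S big_filter_cond; apply: eq_bigl => t.
  by rewrite andbC; case: eqP => [->|//]; rewrite dA.
have bes_b : \sum_(d <- E) S d (b d) <= 1.
  rewrite -sel// -big_filter; apply: (bes b) => //.
  - by rewrite filter_uniq.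
  - by move=> t; rewrite mem_filter => /andP[_]; exact: LF.
  - by move=> t; rewrite mem_filter => /andP[/andP[_ /eqP]].
have wq0 t : L t -> 0 <= w (c t) (h t) * q t.
  by move=> Lt; apply: mulr_ge0 => //; rewrite ltW// w0.
have sub_le (A : seq T) (Q : pred T) : uniq A -> {subset A <= F} ->
    \sum_(t <- A | Q t) w (c t) (h t) * q t <= \sum_(t <- F | Q t) w (c t) (h t) * q t.
  move=> uA AF; have pA : perm_eq A [seq t <- F | t \in A].
    apply: uniq_perm => //; first by rewrite filter_uniq.
    by move=> t; rewrite mem_filter andb_idr//; exact: AF.
  rewrite (perm_big _ pA) big_filter_cond [leRHS](bigID (mem A))/=.
  under eq_bigl do rewrite andbC.
  rewrite lerDl big_seq_cond.
  by apply: sumr_ge0 => t /andP[tF _]; exact: wq0 (LF _ tF).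
have F0F : {subset F0 <= F} by move=> t tF; rewrite memF tF.
have F1F : {subset F1 <= F} by move=> t tF; rewrite memF tF orbT.
have wE d i : d \in E -> (i < M)%N -> 0 <= w d i.
  by rewrite mem_undup => /mapP[t /LF Lt ->] iM; rewrite ltW// w0.
have full_E : 1 - del * (eps / 2) < \sum_(d <- E) \sum_(i < M) w d i * S d i.
  apply: lt_le_trans hF1 _; under [leRHS]eq_bigr do rewrite -sum_class.
  by rewrite -(@sum_by_class _ _ F c E)//; exact: sub_le.
have class_le d : d \in E -> \sum_(i < M) w d i * S d i <= S d (b d).
  move=> dE; rewrite -[leRHS]mul1r -(w1 d) mulr_suml; apply: ler_sum => i _.
  by apply: ler_wpM2l; [exact: wE | exact: bmax].
(* The selection b nearly exhausts the mass already on the labels of F0. *)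
have full_E0 : 1 - eps / 2 < \sum_(d <- E0) S d (b d).
  apply: lt_le_trans hF0 _; rewrite (@sum_by_class _ _ F0 c E0) ?undup_uniq//.
  rewrite big_seq [leRHS]big_seq; apply: ler_sum => d /subE0E/class_le.
  by apply: le_trans; rewrite -sum_class; exact: sub_le.
(* The weights on E0 being at least del, the defect of F bounds the gap. *)
have gap : \sum_(d <- E0) (S d (b d) - S d (s d)) <= eps / 2.
  rewrite -(ler_pM2l del0) mulr_sumr.
  apply: le_trans (_ : \sum_(d <- E0) \sum_(i < M) w d i * (S d (b d) - S d i) <= _).
    rewrite big_seq [leRHS]big_seq; apply: ler_sum => d dE0.
    rewrite (bigD1 (Ordinal (sM d)))//=; apply: le_trans (_ : w d (s d) * (S d (b d) - S d (s d)) <= _).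
      by apply: ler_wpM2r; [rewrite subr_ge0 bmax | exact: hdel].
    rewrite lerDl; apply: sumr_ge0 => i _; apply: mulr_ge0.
      by apply: wE => //; exact: subE0E.
    by rewrite subr_ge0 bmax.
  apply: le_trans (_ : \sum_(d <- E) \sum_(i < M) w d i * (S d (b d) - S d i) <= _).
    have pE : perm_eq E0 [seq d <- E | d \in E0].
      apply: uniq_perm; rewrite ?undup_uniq ?filter_uniq//.
      by move=> d; rewrite mem_filter andb_idr//; exact: subE0E.
    rewrite (perm_big _ pE) big_filter [leRHS](bigID (mem E0))/= lerDl big_seq_cond.
    apply: sumr_ge0 => d /andP[dE _]; apply: sumr_ge0 => i _; apply: mulr_ge0.
      exact: wE.
    by rewrite subr_ge0 bmax.
  have -> : \sum_(d <- E) \sum_(i < M) w d i * (S d (b d) - S d i) =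
      \sum_(d <- E) S d (b d) - \sum_(d <- E) \sum_(i < M) w d i * S d i.
    rewrite -sumrB; apply: eq_bigr => d _; rewrite -[X in X - _]mul1r -(w1 d).
    by rewrite mulr_suml -sumrB; apply: eq_bigr => i _; rewrite mulrBr.
  by move: bes_b full_E; lra.
exists [seq t <- F | (c t \in E0) && (h t == s (c t))]; split.
- by rewrite filter_uniq.
- by move=> t; rewrite mem_filter => /andP[_]; exact: LF.
- by move=> t; rewrite mem_filter => /andP[/andP[_ /eqP]].
rewrite big_filter sel ?undup_uniq//.
by move: gap full_E0; rewrite sumrB; lra.
Qed.

End Selection.

(** * Removing levels from the infinite product *)

Section Removal.
Context {R : realType}.
Local Notation C := R[i].
Variables (N M n : nat -> nat) (phi : R -> C).
Hypothesis hM : forall i, (1 <= i)%N -> (3 <= M i)%N.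
Hypothesis phi_lim : forall x, ccvg (fun k => fourier_fin N M n k x) (phi x).
Hypothesis phi0 : phi 0 = 1.
Hypothesis phi_conj : forall x, conjc (phi x) = phi (- x).

Definition level_mask k (x : R) : C := mask (M k) (n k) (x / (pprod N k)%:R).

Lemma level_mask0 k : (1 <= k)%N -> level_mask k 0 = 1.
Proof.
by move=> k1; rewrite /level_mask mul0r mask0//; exact: leq_trans (hM k1).
Qed.

Lemma level_mask_conj k x : conjc (level_mask k x) = level_mask k (- x).
Proof. by rewrite /level_mask mask_conj mulNr. Qed.

(** The product of the masks of the levels in J; with the complement of J it is the
    product of the remaining ones. *)
Definition removed_mask (J : pred nat) (m : nat) (x : R) : C :=
  \prod_(1 <= i < m.+1 | J i) level_mask i x.

Lemma removed_mask_conj J m x : conjc (removed_mask J m x) = removed_mask J m (- x).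
Proof.
by rewrite /removed_mask conjc_prod; apply: eq_bigr => i _; rewrite level_mask_conj.
Qed.

Lemma posdef_removed J k : posdef (removed_mask J k).
Proof.
elim: k => [|k IH].
  have -> : removed_mask J 0 = fun=> 1.
    by apply/funext => x; rewrite /removed_mask big_nil.
  exact: posdef1.
have -> : removed_mask J k.+1 = fun x =>
    (if J k.+1 then level_mask k.+1 x else 1) * removed_mask J k x.
  apply/funext => x; rewrite /removed_mask big_mkcond big_nat_recr//= -big_mkcond /=.
  by rewrite mulrC.
case: (J k.+1); first exact: posdef_mask.
have -> : (fun x => 1 * removed_mask J k x) = removed_mask J k; last exact: IH.
by apply/funext => x; rewrite mul1r.
Qed.

(** Where the masks of the levels in J do not vanish, phi divided by them is the
    limit of the products of the other masks, which are positive definite. *)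
Lemma bessel_removed (J : pred nat) (m : nat) (xi : R) (F : seq R) :
  (forall i, J i -> (i <= m)%N) -> uniq F ->
  {in xi :: F &, forall x y, removed_mask J m (x - y) != 0} ->
  {in F &, forall x y, x != y -> phi (x - y) = 0} ->
  \sum_(x <- F) nsq (phi (xi - x) / removed_mask J m (xi - x)) <= 1.
Proof.
move=> Jm uF nz orth; pose psi x := phi x / removed_mask J m x.
apply: (@bessel_posdef _ (removed_mask (predC J)) psi) => //.
- by move=> k; exact: posdef_removed.
- rewrite /psi phi0 /removed_mask big1_seq ?divr1// => i /andP[_].
  by rewrite mem_index_iota => /andP[i1 _]; exact: level_mask0.
- move=> x xF; rewrite /psi conjcM conjc_inv phi_conj removed_mask_conj.
  by rewrite opprB.
- by move=> x y xF yF xy; rewrite /psi orth// mul0r.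
- move=> x y xF yF; have := nz x y xF yF; set d := x - y => d0.
  have : ccvg (fun k => fourier_fin N M n k d * (removed_mask J m d)^-1) (psi d).
    by apply: ccvgM; [exact: phi_lim | exact: ccvg_cst].
  apply: (@ccvg_eventually _ _ _ _ m) => k mk.
  rewrite /fourier_fin (bigID J)/= -/(level_mask _ _).
  have -> : \prod_(1 <= i < k.+1 | J i) mask (M i) (n i) (d / (pprod N i)%:R) =
     removed_mask J m d.
    rewrite (@big_cat_nat _ _ _ m.+1)//= [X in _ * X]big1_seq ?mulr1// => i.
    rewrite mem_index_iota => /andP[/Jm im /andP[mi _]].
    by move: (leq_trans mi im); rewrite ltnn.
  by rewrite mulrAC divff ?mul1r.
Qed.

End Removal.

(** * Cosets and classes of frequencies at a level *)

Section Levels.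
Context {R : realType}.
Local Notation C := R[i].
Variables (N M : nat -> nat).

(** The coordinate of x in the lattice (P_k / M_k) Z that contains the zeros of the
    mask of level k, where P_k is the product of the first k contraction ratios.
    The fractional part lev_frac labels the coset of x modulo this lattice, and
    lev_res the class of x modulo P_k Z within this coset. *)
Definition lev k (x : R) : R := x * (M k)%:R / (pprod N k)%:R.
Definition lev_frac k x : R := lev k x - (Num.floor (lev k x))%:~R.
Definition lev_res k x : nat := `|(Num.floor (lev k x) %% (M k)%:Z)%Z|%N.

Lemma lev_res_lt k x : (0 < M k)%N -> (lev_res k x < M k)%N.
Proof.
move=> M0; rewrite /lev_res -ltz_nat gez0_abs ?modz_ge0 ?ltz_pmod//.
by rewrite -lt0n.
Qed.

Lemma lev_resE k x : (0 < M k)%N -> exists q : int,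
  lev k x = lev_frac k x + (lev_res k x)%:R + q%:~R * (M k)%:R.
Proof.
move=> M0; exists (Num.floor (lev k x) %/ (M k)%:Z)%Z.
rewrite /lev_frac /lev_res -[(`|_|)%:R]/((`|_|%N : int)%:~R) gez0_abs ?modz_ge0//; last first.
  by rewrite -lt0n.
rewrite -addrA -[(M k)%:R]/((M k)%:Z%:~R) -intrM -intrD [(_ %% _)%Z + _]addrC -divz_eq.
by rewrite subrK.
Qed.

Lemma levB k x y : lev k (x - y) = lev k x - lev k y.
Proof. by rewrite /lev !mulrBl. Qed.

Lemma lev_frac01 k x : 0 <= lev_frac k x < 1.
Proof.
rewrite /lev_frac subr_ge0 floor_le /= ltrBlDl.
by have := floorD1_gt (lev k x); rewrite intrD.
Qed.

Lemma lev_frac_neq k x y : lev_frac k x != lev_frac k y -> lev k (x - y) \isn't a Num.int.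
Proof.
apply: contra => /intrP[m]; rewrite levB => h.
have hx := lev_frac01 k x; have hy := lev_frac01 k y.
set z := m - Num.floor (lev k x) + Num.floor (lev k y).
have Ed : lev_frac k x - lev_frac k y = z%:~R.
  by rewrite /z !intrD mulrNz -h /lev_frac; ring.
have z1 : z < 1 by rewrite -(ltr_int R) -Ed; lra.
have z2 : -1 < z by rewrite -(ltr_int R) -Ed mulrNz; lra.
have z0 : z = 0 by lia.
by rewrite -subr_eq0 Ed z0.
Qed.

Lemma lev_shift k x y (m : int) : (0 < M k)%N ->
  lev k x = lev k y + (m * M k)%:~R -> lev_frac k x = lev_frac k y /\ lev_res k x = lev_res k y.
Proof.
move=> M0 h; have E : Num.floor (lev k x) = Num.floor (lev k y) + m * M k.
  by rewrite h floorDrz ?intr_int// intrKfloor.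
split; first by rewrite /lev_frac E h intrD; ring.
by rewrite /lev_res E addrC modzMDl.
Qed.

Lemma lev0 k : lev k 0 = 0.
Proof. by rewrite /lev !mul0r. Qed.

Lemma lev_frac0 k : lev_frac k 0 = 0.
Proof. by rewrite /lev_frac lev0 floor0 subrr. Qed.

Lemma lev_res0 k : lev_res k 0 = 0%N.
Proof. by rewrite /lev_res lev0 floor0 mod0z. Qed.

End Levels.

(** * Divisibility from a spectrum *)

Section SpectrumDivides.
Context {R : realType}.
Local Notation C := R[i].
Variables (N M n : nat -> nat) (phi : R -> C).
Hypothesis hN : forall i, (1 <= i)%N -> (0 < N i)%N.
Hypothesis hM : forall i, (1 <= i)%N -> (3 <= M i)%N.
Hypothesis hn : forall i, (1 <= i)%N -> (1 <= n i)%N.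
Hypothesis hgcd : forall k, (1 <= k)%N -> ~~ odd (M k) -> (5 <= M k)%N ->
    gcdn (n k * M k - 1) (M k - 2) = 1%N.
Hypothesis phi_lim : forall x, ccvg (fun k => fourier_fin N M n k x) (phi x).
Hypothesis phi0 : phi 0 = 1.
Hypothesis phi_conj : forall x, conjc (phi x) = phi (- x).

Local Notation level_mask := (@level_mask R N M n).
Local Notation lev := (@lev R N M).
Local Notation lev_frac := (@lev_frac R N M).
Local Notation lev_res := (@lev_res R N M).

Let M0 k : (1 <= k)%N -> (0 < M k)%N. Proof. by move=> /hM; exact: leq_trans. Qed.

Let MR k : (1 <= k)%N -> (M k)%:R != 0 :> R.
Proof. by move=> k1; rewrite pnatr_eq0 -lt0n M0. Qed.

Let PR k : (pprod N k)%:R != 0 :> R.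
Proof. by rewrite pnatr_eq0 -lt0n pprod_gt0. Qed.

Lemma level_mask_neq0 k x : (1 <= k)%N -> lev k x \isn't a Num.int -> level_mask k x != 0.
Proof.
move=> k1; apply: contra => /eqP/mask_eq0 h.
rewrite /lev -mulrA mulrCA; apply: h; [exact: hM | exact: hn | exact: hgcd].
Qed.

Lemma level_mask_same k x y : (1 <= k)%N -> lev_frac k x = lev_frac k y ->
  lev_res k x = lev_res k y -> level_mask k (x - y) = 1.
Proof.
move=> k1 hf hr; apply: mask_int; first exact: M0.
have [q hq] := lev_resE N x (M0 k1); have [q' hq'] := lev_resE N y (M0 k1).
have -> : (x - y) / (pprod N k)%:R = lev k (x - y) / (M k)%:R.
  by rewrite /lev mulrAC mulfK// MR.
rewrite levB hq hq' hf hr (_ : _ - _ = (q - q')%:~R * (M k)%:R); last first.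
  by rewrite intrB; ring.
by rewrite mulfK ?MR// intr_int.
Qed.

(** If one class modulo P_k Z is selected in each coset of (P_k / M_k) Z, then two
    selected points are in the same class, where the mask of the difference is 1 by
    periodicity, or in different cosets, where it does not vanish. *)
Lemma level_mask_selected k (s : R -> nat) x y : (1 <= k)%N ->
  lev_res k x = s (lev_frac k x) -> lev_res k y = s (lev_frac k y) ->
  level_mask k (x - y) != 0.
Proof.
move=> k1 sx sy; have [hf|hf] := eqVneq (lev_frac k x) (lev_frac k y).
  by rewrite level_mask_same ?oner_eq0// sx sy hf.
by apply: level_mask_neq0 => //; exact: lev_frac_neq.
Qed.

Lemma wmask_level k xi x : (1 <= k)%N -> wmask (M k) (n k)
   (xi / (pprod N k)%:R - (lev_frac k x + (lev_res k x)%:R) / (M k)%:R) =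
  nsq (level_mask k (xi - x)).
Proof.
move=> k1; have [q hq] := lev_resE N x (M0 k1); congr nsq.
rewrite -(mask_Dint _ _ _ (- q)); congr mask.
have E : x = lev k x * (pprod N k)%:R / (M k)%:R.
  by rewrite /lev mulfVK// mulfK// MR.
rewrite [in RHS]E hq mulrNz; move: (lev_frac _ _) (lev_res _ _)%:R => a b.
have := MR k1; have := PR k; move: (M k)%:R (pprod N k)%:R => m p p0 m0.
by field; rewrite p0 m0.
Qed.

(** Removal of level k. The weights are the values of the squared mask on the
    classes, which have sum 1 by sum_wmask and are positive for generic xi. So
    selection_full_sum turns Parseval for all levels into Parseval for the
    remaining ones and any selected family. *)
Lemma level_step (L : set R) k xi (q : R -> R) : (1 <= k)%N ->
  (forall x, 0 <= q x) ->
  (forall x, L x -> lev k (xi - x) \isn't a Num.int) ->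
  (forall eps : R, 0 < eps -> exists F : seq R, [/\ uniq F, {in F, forall x, L x} &
     1 - eps < \sum_(x <- F) nsq (level_mask k (xi - x)) * q x]) ->
  (forall s : R -> nat, (forall d, (s d < M k)%N) -> forall F : seq R, uniq F ->
     {in F, forall x, L x} -> {in F, forall x, lev_res k x = s (lev_frac k x)} ->
     \sum_(x <- F) q x <= 1) ->
  forall s : R -> nat, (forall d, (s d < M k)%N) -> forall eps : R, 0 < eps ->
    exists F : seq R, [/\ uniq F, {in F, forall x, L x},
      {in F, forall x, lev_res k x = s (lev_frac k x)} & 1 - eps < \sum_(x <- F) q x].
Proof.
move=> k1 q0 gen full bes.
pose w (c : R) (i : nat) := wmask (M k) (n k) (xi / (pprod N k)%:R - (c + i%:R) / (M k)%:R).
apply: (@selection_full_sum R R R (M k) (lev_frac k) (lev_res k) w q L (M0 k1)) => //.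
- by move=> x; apply: lev_res_lt; exact: M0.
- move=> x i Lx iM; rewrite lt_def wmask_ge0 andbT /w /wmask nsq_eq0.
  have h := gen x Lx; apply: contra h => /eqP/mask_eq0 hm.
  have {hm} := hm (hM k1) (hn k1) (@hgcd k k1).
  have -> : (M k)%:R * (xi / (pprod N k)%:R - (lev_frac k x + i%:R) / (M k)%:R) =
     lev k (xi - x) + (Num.floor (lev k x) - i%:Z)%:~R.
    rewrite levB intrB /lev_frac -[(i%:Z)%:~R]/(i%:R); move: (lev k x) => l.
    rewrite /lev; have := MR k1; have := PR k.
    move: (M k)%:R (pprod N k)%:R (i%:R : R) => m p i' p0 m0.
    by field; rewrite p0 m0.
  by rewrite rpredDr// intr_int.
- move=> d; rewrite /w -[RHS](@sum_wmask R (M k) (n k) (xi / (pprod N k)%:R - d / (M k)%:R)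
    (fun h => h%:Z) (M0 k1) (hn k1))//.
  by apply: eq_bigr => i _; congr wmask; rewrite mulrDl opprD addrA.
- move=> eps e0; have [F [uF FL hF]] := full eps e0; exists F; split => //.
  by rewrite /w; under eq_bigr do rewrite wmask_level//.
Qed.

Lemma removed_mask1 k x : (1 <= k)%N -> removed_mask N M n (pred1 k) k x = level_mask k x.
Proof.
case: k => // k _; rewrite /removed_mask big_mkcond big_nat_recr//= eqxx.
rewrite big_nat_cond big1 ?mul1r//= => i; rewrite andbT => /andP[_ ik].
by rewrite ltn_eqF.
Qed.

Lemma removed_mask2 k x : (1 <= k)%N ->
  removed_mask N M n (pred2 k k.+1) k.+1 x = level_mask k x * level_mask k.+1 x.
Proof.
case: k => // k _; rewrite /removed_mask big_mkcond big_nat_recr//= big_nat_recr//=.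
have -> : (k.+1 == k.+1) || (k.+1 == k.+2) by apply/orP; left; apply/eqP.
have -> : (k.+2 == k.+1) || (k.+2 == k.+2) by apply/orP; right; apply/eqP.
rewrite big_nat_cond big1 ?mul1r//= => i; rewrite andbT => /andP[_ ik].
by rewrite !ltn_eqF// ltnW.
Qed.

(** Write j = k + 1 and let g = P_j / M_j generate the lattice of level j. If M_j
    does not divide N_j, then g is not in P_k Z, so at level k one can select 0 and
    drop the class of g. Next, in the coset of 0 at level j select the class of g:
    since g + P_j Z is contained in the dropped class g + P_k Z, nothing of this
    coset is left. Both selections keep Parseval, but 0 is orthogonal to all that
    remains, so that Bessel's inequality leaves no room for phi xi != 0. *)
Theorem spectrum_divides (L : set R) k xi : (1 <= k)%N -> L 0 ->
  orthogonal_spectrum phi L -> parseval_at phi L xi ->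
  (forall x, L x -> lev k (xi - x) \isn't a Num.int) ->
  (forall x, L x -> lev k.+1 (xi - x) \isn't a Num.int) ->
  phi xi != 0 -> (M k.+1 %| N k.+1)%N.
Proof.
move=> k1 L0 oL pL gk gj phixi.
have k2 : (1 <= k.+1)%N by [].
have [//|ndvd] := boolP (M k.+1 %| N k.+1)%N; exfalso.
(* The generator of the lattice of level k.+1. *)
pose g : R := (pprod N k.+1)%:R / (M k.+1)%:R.
have [q hg] := lev_resE N g (M0 k1).
have g_nonzero : (lev_frac k g, lev_res k g) <> (0, 0%N).
  case=> g1 g2; move: hg; rewrite g1 g2 !add0r => hg; move/negP: ndvd; apply.
  have E : (N k.+1)%:Z%:~R = (q * M k.+1)%:~R :> R.
    apply: (@mulIf _ (M k)%:R); first exact: MR.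
    rewrite intrM -[(M k.+1)%:Z%:~R]/((M k.+1)%:R) mulrAC -hg /lev /g pprodS natrM.
    have := MR k2; have := PR k; rewrite -[(N k.+1)%:Z%:~R]/((N k.+1)%:R).
    move: (M k)%:R (pprod N k)%:R (M k.+1)%:R (N k.+1)%:R => m p m' n' p0 m0.
    by field; rewrite p0 m0.
  have /intr_inj Ez := E; rewrite -[(_ %| _)%N]/((M k.+1)%:Z %| (N k.+1)%:Z)%Z.
  by rewrite Ez dvdz_mull.
have g_shift x : lev_frac k.+1 x = 0 -> lev_res k.+1 x = 1%N ->
    lev_frac k x = lev_frac k g /\ lev_res k x = lev_res k g.
  move=> x0 x1; have [t ht] := lev_resE N x (M0 k2).
  apply: (@lev_shift R N M k x g (t * N k.+1)); first exact: M0.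
  have E : x = lev k.+1 x * (pprod N k.+1)%:R / (M k.+1)%:R.
    by rewrite /lev mulfVK// mulfK// MR.
  rewrite {1}E ht x0 x1 add0r /lev /g !intrM pprodS natrM.
  rewrite -[(N k.+1)%:Z%:~R]/((N k.+1)%:R) -[(M k)%:Z%:~R]/((M k)%:R).
  have := MR k2; have := PR k.
  move: (M k)%:R (pprod N k)%:R (M k.+1)%:R (N k.+1)%:R => m p m' n' p0 m0.
  by field; rewrite p0 m0.
(* This selection keeps 0 and drops the class of g. *)
pose s (c : R) : nat := if c == 0 then 0%N else if lev_res k g == 0%N then 1%N else 0%N.
have sM c : (s c < M k)%N.
  have := hM k1; rewrite /s; case: ifP => _; first by case: (M k).
  by case: ifP => _; case: (M k) => [|[|]].
have sg : lev_res k g <> s (lev_frac k g).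
  rewrite /s; case: eqP => [g0 g1|_]; first by apply: g_nonzero; rewrite g0 g1.
  by case: eqP => [->|].
have s0 : lev_res k 0 = s (lev_frac k 0) by rewrite lev_res0 lev_frac0 /s eqxx.
pose q1 x := nsq (phi (xi - x) / removed_mask N M n (pred1 k) k (xi - x)).
pose q2 x := nsq (phi (xi - x) / removed_mask N M n (pred2 k k.+1) k.+1 (xi - x)).
have neg i x : lev i (xi - x) \isn't a Num.int -> lev i (x - xi) \isn't a Num.int.
  by rewrite -(opprB xi x) /lev !mulNr rpredN.
have step1 s' : (forall d, (s' d < M k)%N) -> forall eps : R, 0 < eps ->
    exists F : seq R, [/\ uniq F, {in F, forall x, L x},
      {in F, forall x, lev_res k x = s' (lev_frac k x)} & 1 - eps < \sum_(x <- F) q1 x].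
  apply: (@level_step L k xi q1 k1 (fun x => nsq_ge0 _) gk).
    move=> eps e0; have [F [uF FL hF]] := pL eps e0; exists F; split => //.
    rewrite [ltRHS](_ : _ = \sum_(x <- F) nsq (phi (xi - x)))//.
    apply: eq_big_seq => x xF; rewrite /q1 removed_mask1// -nsqM mulrC mulfVK//.
    by apply: level_mask_neq0 => //; exact: gk (FL _ xF).
  move=> r rM F uF FL Fr; rewrite /q1.
  apply: (bessel_removed hM phi_lim phi0 phi_conj) => //.
  - by move=> i /eqP ->.
  - move=> x y; rewrite !inE => /orP[/eqP->|xF] /orP[/eqP->|yF]; rewrite removed_mask1//.
    + by rewrite subrr level_mask0// oner_eq0.
    + by apply: level_mask_neq0 => //; exact: gk (FL _ yF).
    + by apply: level_mask_neq0 => //; apply: neg; exact: gk (FL _ xF).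
    + by apply: (@level_mask_selected _ r) => //; exact: Fr.
  - by move=> x y xF yF; apply: oL; exact: FL.
pose L1 x := L x /\ lev_res k x = s (lev_frac k x).
have bes2 (F : seq R) : uniq F -> {in F, forall x, L1 x} ->
    {in F &, forall x y, x != y -> level_mask k.+1 (x - y) != 0} -> \sum_(x <- F) q2 x <= 1.
  move=> uF FL Fj; apply: (bessel_removed hM phi_lim phi0 phi_conj) => //.
  - by move=> i /orP[] /eqP ->.
  - move=> x y; rewrite !inE => /orP[/eqP->|xF] /orP[/eqP->|yF]; rewrite removed_mask2// mulf_neq0//.
    + by rewrite subrr level_mask0// oner_eq0.
    + by rewrite subrr level_mask0// oner_eq0.
    + by apply: level_mask_neq0 => //; exact: gk (FL _ yF).1.
    + by apply: level_mask_neq0 => //; exact: gj (FL _ yF).1.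
    + by apply: level_mask_neq0 => //; apply: neg; exact: gk (FL _ xF).1.
    + by apply: level_mask_neq0 => //; apply: neg; exact: gj (FL _ xF).1.
    + by apply: (@level_mask_selected _ s) => //; [exact: (FL _ xF).2 | exact: (FL _ yF).2].
    + have [->|xy] := eqVneq x y; last exact: Fj.
      by rewrite subrr level_mask0// oner_eq0.
  - by move=> x y xF yF; apply: oL; [exact: (FL _ xF).1 | exact: (FL _ yF).1].
have step2 s' : (forall d, (s' d < M k.+1)%N) -> forall eps : R, 0 < eps ->
    exists F : seq R, [/\ uniq F, {in F, forall x, L1 x},
      {in F, forall x, lev_res k.+1 x = s' (lev_frac k.+1 x)} & 1 - eps < \sum_(x <- F) q2 x].
  apply: (@level_step L1 k.+1 xi q2 k2 (fun x => nsq_ge0 _)).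
  - by move=> x [Lx _]; exact: gj.
  - move=> eps e0; have [F [uF FL Fs hF]] := step1 s sM eps e0; exists F; split => //.
      by move=> x xF; split; [exact: FL | exact: Fs].
    rewrite [ltRHS](_ : _ = \sum_(x <- F) q1 x)//.
    apply: eq_big_seq => x xF; rewrite /q1 /q2 removed_mask1// removed_mask2// -nsqM.
    congr nsq; rewrite mulrC -mulrA; congr (_ * _); rewrite invfM -mulrA mulVf ?mulr1//.
    by apply: level_mask_neq0 => //; exact: gj (FL _ xF).
  - move=> r rM F uF FL Fr; apply: bes2 => // x y xF yF _.
    by apply: (@level_mask_selected _ r) => //; exact: Fr.
(* In the coset of 0, labelled 0, select the class of g, which has residue 1. *)
pose s2 (c : R) : nat := (c == 0).
have s2M c : (s2 c < M k.+1)%N.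
  by have := hM k2; rewrite /s2; case: (M k.+1) => [|[|]] //; case: (c == 0).
have q20 : 0 < q2 0.
  rewrite /q2 subr0 lt_def nsq_ge0 andbT nsq_eq0 mulf_neq0// invr_eq0.
  rewrite removed_mask2// mulf_neq0// -(subr0 xi); apply: level_mask_neq0 => //.
    exact: gk.
  exact: gj.
have [F [uF FL Fs hF]] := step2 s2 s2M _ q20.
have Fz x : x \in F -> lev_frac k.+1 x != 0.
  move=> xF; apply/negP => /eqP x0; have := Fs x xF; rewrite x0 /s2 eqxx => x1.
  have [f1 f2] := g_shift x x0 x1; have [_] := FL x xF.
  by rewrite f1 f2.
(* As x is not in the coset of 0, the difference with 0 is not a zero at level k.+1. *)
have nz0 x : x \in F -> level_mask k.+1 (0 - x) != 0 /\ level_mask k.+1 (x - 0) != 0.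
  by move=> xF; split; apply: level_mask_neq0 => //; apply: lev_frac_neq;
     rewrite lev_frac0 ?Fz// eq_sym Fz.
have : \sum_(x <- 0 :: F) q2 x <= 1.
  apply: bes2.
  - rewrite /= uF andbT; apply/negP => /Fz.
    by rewrite lev_frac0 eqxx.
  - by move=> x; rewrite inE => /orP[/eqP->|/FL].
  - move=> x y; rewrite !inE => /orP[/eqP->|xF] /orP[/eqP->|yF].
    + by rewrite eqxx.
    + by move=> _; case: (nz0 _ yF).
    + by move=> _; case: (nz0 _ xF).
    + by move=> _; apply: (@level_mask_selected _ s2) => //; exact: Fs.
by rewrite big_cons; move: hF; lra.
Qed.
End SpectrumDivides.

(** * Generic points *)

Section Generic.
Context {R : realType}.
Local Notation RR := (measurableTypeR R).
Local Notation C := R[i].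
Variable mu : probability RR R.

(** Continuity of the transform at 0, by dominated convergence. *)
Lemma fourier_cvg0 (x_ : nat -> R) : x_ m @[m --> \oo] --> (0 : R) ->
  complex.Re (fourier mu (x_ m)) @[m --> \oo] --> (1 : R).
Proof.
move=> x0.
have -> : (1 : R) = complex.Re (fourier mu 0) by rewrite fourier0.
pose f_ (m : nat) (x : RR) : \bar R := (complex.Re (expo (x_ m) x))%:E.
have cv : ((\int[mu]_x f_ m x) @[m --> \oo] --> \int[mu]_x (complex.Re (expo 0 x))%:E)%E.
  apply: (@dominated_cvg _ _ _ mu setT measurableT _ _ (cst 1%E)) => //.
  - by move=> m; apply/measurable_EFinP; case: (measurable_expo (x_ m)).
  - move=> x _; apply: cvg_EFin; first exact: nearW.
    have c : {for 0, continuous (fun t : R => complex.Re (expo t x))}.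
      have h : continuous (fun t : R => - (2 * pi * t * x)).
        move=> t; apply: cvgN; apply: cvgM; last exact: cvg_cst.
        by apply: cvgM; [exact: cvg_cst | exact: cvg_id].
      by apply: (continuous_comp (h 0)); exact: continuous_cos.
    apply: (@cvg_comp _ _ _ x_ (fun t => complex.Re (expo t x)) _ _ _ x0); exact: c.
  - exact: (@integrable_cst _ mu 1).
  - by move=> m x _ /=; rewrite lee_fin; exact: cos_max.
apply: fine_cvg; rewrite fineK//.
by apply: integrable_fin_num => //; case: (cintegrable_expo mu 0).
Qed.

Lemma countable_avoid (E : set R) (a : R) : countable E -> 0 < a ->
  exists2 x, 0 < x < a & ~ E x.
Proof.
move=> cE a0; apply: contrapT => h.
have sub : `]0, a[%classic `<=` E.
  move=> x /=; rewrite in_itv /= => xa; apply: contrapT => nE.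
  by apply: h; exists x.
have := countable_lebesgue_measure0 (sub_countable (subset_card_le sub) cE).
by rewrite lebesgue_measure_itv /= lte_fin a0 sube0 => -[] a00; rewrite a00 ltxx in a0.
Qed.

(** The transform is nonzero near 0 by continuity, and no interval is covered by a
    countable set. *)
Lemma exists_generic (E : set R) : countable E -> exists2 xi, ~ E xi & fourier mu xi != 0.
Proof.
move=> cE; have h m : {x : R | 0 < x < m.+1%:R^-1 /\ ~ E x}.
  have m0 : (0 : R) < m.+1%:R^-1 by rewrite invr_gt0.
  by apply: cid; have [x xm nE] := countable_avoid cE m0; exists x.
pose x_ m := projT1 (h m).
have x0 : x_ m @[m --> \oo] --> (0 : R).
  apply: (@squeeze_cvgr _ _ _ _ (fun=> 0) (fun m => m.+1%:R^-1)).
  - apply: nearW => m; have [/andP[a b] _] := projT2 (h m).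
    by rewrite -/(x_ m) !ltW.
  - exact: cvg_cst.
  - exact: cvg_harmonic.
have cv := fourier_cvg0 x0.
have [m _ hm] : \forall m \near \oo, 0 < complex.Re (fourier mu (x_ m)).
  by apply: (cvgr_gt _ cv).
exists (x_ m); first by case: (projT2 (h m)).
apply/eqP => z; have : 0 < complex.Re (fourier mu (x_ m)) by exact: (hm m (leqnn m)).
by rewrite z ltxx.
Qed.

End Generic.

(** * Necessity *)

Section Necessity.
Context {R : realType}.
Local Notation RR := (measurableTypeR R).
Variables (N M n : nat -> nat).
Hypothesis hM : forall k, (1 <= k)%N -> (3 <= M k)%N.
Hypothesis hN : forall k, (1 <= k)%N -> (0 < N k)%N.
Hypothesis hn : forall k, (1 <= k)%N -> (1 <= n k)%N.
Hypothesis hgcd : forall k, (1 <= k)%N -> ~~ odd (M k) -> (5 <= M k)%N ->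
    gcdn (n k * M k - 1) (M k - 2) = 1%N.
Variable mu : probability RR R.
Hypothesis hmu : is_infinite_convolution N (fun k => digit_set (M k) (n k)) mu.

Lemma fourier_fin_cvg xi : ccvg (fun k => fourier_fin N M n k xi) (fourier mu xi).
Proof.
have := weak_cvg_fourier xi hmu; apply: (@ccvg_eventually _ _ _ _ 0%N) => k _.
by apply: fourier_finite_convolution => // i i1; exact: ltnW (hM i1).
Qed.

(** A translate of the spectrum contains 0, and a generic xi avoids the countably
    many points where a mask of level k or k + 1 could vanish on xi minus the
    spectrum. *)
Theorem spectral_divides k : (1 <= k)%N -> spectral_measure mu -> (M k.+1 %| N k.+1)%N.
Proof.
move=> k1 /spectral_parseval[L [cL oL pL]].
have half0 : (0 : R) < 1 / 2 by lra.
have [F [_ FL hF]] := pL 0 _ half0.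
have [x0 Lx0] : exists x0, L x0.
  case: F FL hF => [_|x F FL _]; first by rewrite big_nil; lra.
  by exists x; apply: FL; rewrite mem_head.
pose L' : set R := [set x | L (x + x0)].
pose gen i (p : R * int) : R := p.1 - x0 + p.2%:~R * (pprod N i)%:R / (M i)%:R.
have cE : countable (\bigcup_(p in L `*` setT) [set gen k p; gen k.+1 p]).
  apply: bigcup_countable; first by apply: countableX => //; exact: countableP.
  by move=> p _; apply: finite_set_countable; exact: finite_set2.
have [xi nE phixi] := exists_generic mu cE.
have generic i x : (1 <= i)%N -> (forall p, L p.1 -> xi <> gen i p) -> L' x ->
    @lev R N M i (xi - x) \isn't a Num.int.
  move=> i1 ni Lx; apply/negP => /intrP[m hm]; apply: (ni (x + x0, m)) => //.
  have p0 : (pprod N i)%:R != 0 :> R by rewrite pnatr_eq0 -lt0n pprod_gt0.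
  have m0 : (M i)%:R != 0 :> R by rewrite pnatr_eq0 -lt0n (leq_trans _ (hM i1)).
  by rewrite /gen /= -hm /lev mulfVK// mulfK// addrK addrC subrK.
apply: (@spectrum_divides R N M n (fourier mu) hN hM hn hgcd fourier_fin_cvg (fourier0 mu) _ L' k xi k1) => //.
- exact: fourier_conj.
- by rewrite /L' /= add0r.
- move=> x y Lx Ly xy; have := oL _ _ Lx Ly; rewrite opprD addrACA subrr addr0; apply.
  by apply: contra xy => /eqP/addIr ->.
- move=> eps e0; have [G [uG GL hG]] := pL (xi + x0) eps e0.
  exists [seq x - x0 | x <- G]; split.
  + by rewrite map_inj_uniq// => x y /addIr.
  + by move=> _ /mapP[x xG ->]; rewrite /L' /= subrK; exact: GL.
  + rewrite big_map; apply: lt_le_trans hG _.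
    by apply: ler_sum => x _; rewrite opprB addrA.
- by move=> x Lx; apply: generic => // p Lp h; apply: nE; exists p => //; left.
- by move=> x Lx; apply: generic => // p Lp h; apply: nE; exists p => //; right.
Qed.

End Necessity.

(** * Spectra of the finite convolutions under divisibility *)

Section CanonicalSpectrum.
Context {R : realType}.
Local Notation C := R[i].
Variables (N M n : nat -> nat).
Hypothesis hM : forall k, (1 <= k)%N -> (3 <= M k)%N.
Hypothesis hMN : forall k, (1 <= k)%N -> (M k <= N k)%N.
Hypothesis hn : forall k, (1 <= k)%N -> (1 <= n k)%N.
Hypothesis hdiv : forall k, (2 <= k)%N -> (M k %| N k)%N.

Local Notation fourier_fin := (@fourier_fin R N M n).

Let M0 k : (1 <= k)%N -> (0 < M k)%N. Proof. by move=> /hM; exact: leq_trans. Qed.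

Let N3 k : (1 <= k)%N -> (3 <= N k)%N.
Proof. by move=> k1; exact: leq_trans (hM k1) (hMN k1). Qed.

Let N0 k : (1 <= k)%N -> (0 < N k)%N. Proof. by move=> /N3; exact: leq_trans. Qed.

Let PR0 k : (0 : R) < (pprod N k)%:R. Proof. by rewrite ltr0n pprod_gt0. Qed.

Let MR0 k : (1 <= k)%N -> (0 : R) < (M k)%:R. Proof. by move=> k1; rewrite ltr0n M0. Qed.

(** The representative of h modulo m that is at most m / 2 in absolute value; small
    representatives keep the finite spectra within the first period of the tail. *)
Definition centered (m h : nat) : int := if (h.*2 <= m)%N then h%:Z else h%:Z - m%:Z.

Lemma centered_mod m h : (centered m h = h%:Z %[mod m])%Z.
Proof.
rewrite /centered; case: ifP => // _.
by have := modzMDl (-1) h%:Z m%:Z; rewrite mulN1r addrC.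
Qed.

Lemma centered_le m h : (h < m)%N -> `|(centered m h)%:~R : R| <= m%:R / 2.
Proof.
rewrite /centered => hm; case: ifP => h2.
  rewrite ger0_norm ?ler0z// ler_pdivlMr// -[h%:Z%:~R]/(h%:R) -natrM ler_nat.
  by rewrite muln2.
rewrite intrB -[h%:Z%:~R]/(h%:R) -[m%:Z%:~R]/(m%:R).
have h3 : (m%:R : R) <= h%:R * 2 by rewrite -natrM ler_nat muln2 ltnW// ltnNge h2.
have h4 : (h%:R : R) <= m%:R by rewrite ler_nat ltnW.
by rewrite ler0_norm ?subr_le0//; lra.
Qed.

(** The spectrum of the product of the first k levels, in the style of a digit
    expansion: level i contributes a multiple of P_i / M_i. *)
Fixpoint level_spectrum (k : nat) : seq R :=
  if k is k'.+1 then
    [seq x + (pprod N k)%:R / (M k)%:R * (centered (M k) h)%:~R | x <- level_spectrum k', h <- iota 0 (M k)]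
  else [:: 0].

Lemma pprod_dvd i k : (i <= k)%N -> (pprod N i %| pprod N k)%N.
Proof.
elim: k => [|k IH]; first by rewrite leqn0 => /eqP ->.
rewrite leq_eqVlt ltnS => /orP[/eqP -> //|/IH h].
by rewrite pprodS dvdn_mulr.
Qed.

Lemma fourier_finS k x : fourier_fin k.+1 x = fourier_fin k x * mask (M k.+1) (n k.+1) (x / (pprod N k.+1)%:R).
Proof. by rewrite /fourier_fin big_nat_recr. Qed.

(** The shifts of level k + 1 are multiples of P_k, because M_(k+1) divides N_(k+1);
    for k = 0 the product is empty. *)
Lemma fourier_fin_periodic k x (l : int) :
  fourier_fin k (x - (pprod N k.+1)%:R / (M k.+1)%:R * l%:~R) = fourier_fin k x.
Proof.
rewrite /fourier_fin big_nat_cond [RHS]big_nat_cond; apply: eq_bigr => i.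
rewrite andbT => /andP[i1 ik].
have /dvdnP[a ha] : (M k.+1 %| N k.+1)%N by apply: hdiv; rewrite ltnS (leq_trans i1).
have /dvdnP[b hb] : (pprod N i %| pprod N k)%N by apply: pprod_dvd.
rewrite mulrBl -[RHS](mask_Dint _ _ _ (- (b%:Z * a%:Z * l))) mulrNz; congr mask; congr (_ - _).
rewrite pprodS hb ha !natrM !intrM -[b%:Z%:~R]/(b%:R) -[a%:Z%:~R]/(a%:R).
have := MR0 (ltn0Sn k); have := PR0 i; move: (M k.+1)%:R (pprod N i)%:R (a%:R : R) (b%:R : R) l%:~R.
by move=> m p a' b' l' p0 m0; field; rewrite !gt_eqF.
Qed.

(** The new shifts are periods of all previous masks, and the sum over them of the
    new mask is 1. *)
Lemma sum_level_spectrum k xi : \sum_(x <- level_spectrum k) nsq (fourier_fin k (xi - x)) = 1.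
Proof.
elim: k => [|k IH]; first by rewrite big_seq1 /fourier_fin big_nil nsq1.
rewrite /= big_allpairs_dep -[RHS]IH; apply: eq_bigr => x _.
transitivity (\sum_(h <- iota 0 (M k.+1)) nsq (fourier_fin k (xi - x)) *
   wmask (M k.+1) (n k.+1) ((xi - x) / (pprod N k.+1)%:R -
     (centered (M k.+1) h)%:~R / (M k.+1)%:R)).
  apply: eq_bigr => h _; rewrite fourier_finS nsqM opprD addrA fourier_fin_periodic; congr (_ * nsq (mask _ _ _)).
  have := MR0 (ltn0Sn k); have := PR0 k.+1; move: (M k.+1)%:R (pprod N k.+1)%:R _%:~R (xi - x).
  by move=> m p l y p0 m0; field; rewrite !gt_eqF.
have := @sum_wmask R (M k.+1) (n k.+1) ((xi - x) / (pprod N k.+1)%:R) (centered (M k.+1))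
  (M0 (ltn0Sn k)) (hn (ltn0Sn k)) (fun h _ => centered_mod _ _).
rewrite -(big_mkord xpredT (fun h => wmask _ _ (_ - (centered (M k.+1) h)%:~R / _))).
by rewrite /index_iota subn0 -mulr_sumr => ->; rewrite mulr1.
Qed.

Lemma fourier_fin0 k : fourier_fin k 0 = 1.
Proof.
rewrite /fourier_fin big_nat_cond big1// => i /andP[/andP[i1 _] _].
by rewrite mul0r mask0// M0.
Qed.

(** For xi in F the term of xi alone makes 1, so the other terms vanish. *)
Lemma uniq_of_sum (f : R -> C) (F : seq R) : f 0 = 1 ->
  (forall xi, \sum_(x <- F) nsq (f (xi - x)) = 1) ->
  uniq F /\ {in F &, forall x y, x != y -> f (x - y) = 0}.
Proof.
move=> f0 h; have key x y : x \in F -> y \in rem x F -> f (x - y) = 0.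
  move=> xF yF; have := h x; rewrite (big_rem x)//= subrr f0 nsq1.
  move=> /(canRL (addKr _)); rewrite addNr => /eqP.
  rewrite psumr_eq0; last by move=> z _; exact: nsq_ge0.
  by move=> /allP/(_ _ yF); rewrite nsq_eq0 => /eqP.
have nr x : x \in F -> x \notin rem x F.
  move=> xF; apply/negP => xr; have := key x x xF xr.
  by rewrite subrr f0 => /eqP; rewrite oner_eq0.
split.
  apply: count_mem_uniq => x; case: (boolP (x \in F)) => [xF|/count_memPn //].
  by rewrite (permP (perm_to_rem xF)) /= eqxx (count_memPn (nr _ xF)).
move=> x y xF yF xy; apply: key => //.
by move: yF; rewrite (perm_mem (perm_to_rem xF)) inE eq_sym (negbTE xy).
Qed.

Lemma level_spectrum_uniq k : uniq (level_spectrum k).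
Proof. by have [] := uniq_of_sum (fourier_fin0 k) (sum_level_spectrum k). Qed.

Lemma level_spectrum_orth k : {in level_spectrum k &, forall x y, x != y -> fourier_fin k (x - y) = 0}.
Proof. by have [] := uniq_of_sum (fourier_fin0 k) (sum_level_spectrum k). Qed.

Lemma level_spectrum_sub k m : (k <= m)%N -> {subset level_spectrum k <= level_spectrum m}.
Proof.
elim: m => [|m IH]; first by rewrite leqn0 => /eqP ->.
rewrite leq_eqVlt ltnS => /orP[/eqP -> //|/IH h] x /h xm /=.
apply/allpairsP; exists (x, 0%N); split => //=.
  by rewrite mem_iota /= M0.
by rewrite /centered /= mulr0 addr0.
Qed.

Lemma pprodS3 k : 3 * (pprod N k)%:R <= (pprod N k.+1)%:R :> R.
Proof.
by rewrite -natrM ler_nat pprodS mulnC leq_mul2l N3 ?orbT.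
Qed.

Lemma level_spectrum_step_le k x : x \in level_spectrum k.+1 -> exists2 y, y \in level_spectrum k &
  `|x| <= `|y| + (pprod N k.+1)%:R / 2.
Proof.
move=> /allpairsP[[y h] /= [ys]]; rewrite mem_iota add0n => /andP[_ hM'] ->.
exists y => //; apply: le_trans (ler_normD _ _) _; rewrite lerD2l.
have mp := MR0 (ltn0Sn k); have pp := PR0 k.+1.
rewrite normrM ger0_norm; last by rewrite divr_ge0 ?ltW.
apply: le_trans (ler_wpM2l _ (centered_le hM')) _; first by rewrite divr_ge0 ?ltW.
by rewrite mulrA mulfVK ?gt_eqF.
Qed.

(** The bounds P_i / 2 of the successive contributions add up to at most 3 P_k / 4
    because the ratios are at least 3. *)
Lemma level_spectrum_le k x : x \in level_spectrum k -> `|x| <= 3 / 4 * (pprod N k)%:R.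
Proof.
elim: k x => [|k IH] x.
  by rewrite inE => /eqP ->; rewrite normr0 mulr_ge0.
move=> /level_spectrum_step_le[y /IH]; have := pprodS3 k.
by move: (pprod N k)%:R (pprod N k.+1)%:R `|x| `|y| => *; lra.
Qed.

Lemma level_spectrum_le_large k x : (100 <= N k.+1)%N -> x \in level_spectrum k.+1 ->
  `|x| <= (1 / 2 + 3 / 400) * (pprod N k.+1)%:R.
Proof.
move=> N100 /level_spectrum_step_le[y /level_spectrum_le]; have : 100 * (pprod N k)%:R <= (pprod N k.+1)%:R :> R.
  by rewrite -natrM ler_nat pprodS mulnC leq_mul2l N100 orbT.
by move: (pprod N k)%:R (pprod N k.+1)%:R `|x| `|y| => *; lra.
Qed.

End CanonicalSpectrum.

(** * Lower bounds for the tail of the product *)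

Section Tails.
Context {R : realType}.
Local Notation C := R[i].
Variables (N M n : nat -> nat).
Hypothesis hM : forall k, (1 <= k)%N -> (3 <= M k)%N.
Hypothesis hMN : forall k, (1 <= k)%N -> (M k <= N k)%N.
Hypothesis hn : forall k, (1 <= k)%N -> (1 <= n k)%N.

Local Notation fourier_fin := (@fourier_fin R N M n).

Let M0 k : (1 <= k)%N -> (0 < M k)%N. Proof. by move=> /hM; exact: leq_trans. Qed.

Let N0 k : (1 <= k)%N -> (0 < N k)%N.
Proof. by move=> k1; exact: leq_trans (M0 k1) (hMN k1). Qed.

Let PR0 k : (0 : R) < (pprod N k)%:R. Proof. by rewrite ltr0n pprod_gt0. Qed.

Let MR0 k : (1 <= k)%N -> (0 : R) < (M k)%:R. Proof. by move=> k1; rewrite ltr0n M0. Qed.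

(** Weierstrass's inequality. *)
Lemma prod_ge_1_sub_sum (I : Type) (s : seq I) (P : pred I) (w : I -> R) :
  (forall i, P i -> 0 <= w i <= 1) ->
  1 - \sum_(i <- s | P i) (1 - w i) <= \prod_(i <- s | P i) w i.
Proof.
move=> h; suff : 1 - \sum_(i <- s | P i) (1 - w i) <= \prod_(i <- s | P i) w i /\
    0 <= \prod_(i <- s | P i) w i <= 1 by case.
elim: s => [|a s [IH1 IH2]]; first by rewrite !big_nil; lra.
rewrite !big_cons; case: ifP => // /h ha; split; last first.
  by apply/andP; split; nra.
move: IH1 IH2; move: (\sum_(j <- s | _) _) (\prod_(j <- s | _) _) => S Q.
by nra.
Qed.

Definition level_weight k (d : R) : R := wmask (M k) (n k) (d / (pprod N k)%:R).

Lemma wmask_le1 m l (x : R) : (0 < m)%N -> (0 < l)%N -> wmask m l x <= 1.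
Proof.
move=> m0 l0; have := @sum_wmask R m l x (fun h => h%:Z) m0 l0 (fun h _ => erefl).
rewrite (bigD1 (Ordinal m0))//= mul0r subr0 => <-.
by rewrite lerDl; apply: sumr_ge0 => i _; exact: wmask_ge0.
Qed.

Lemma level_weight01 k d : (1 <= k)%N -> 0 <= level_weight k d <= 1.
Proof. by move=> k1; rewrite wmask_ge0 wmask_le1// ?M0 ?hn. Qed.

Lemma fourier_fin_tail m k d : (m <= k)%N ->
  nsq (fourier_fin k d) = nsq (fourier_fin m d) * \prod_(m.+1 <= i < k.+1) level_weight i d.
Proof.
by move=> mk; rewrite /fourier_fin (@big_cat_nat _ _ _ m.+1)//= nsqM [X in _ * X]nsq_prod.
Qed.

Lemma level_weight_first m d : (100 <= M m.+1)%N ->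
  `|d| <= 14 / 25 * (pprod N m)%:R -> 1 / 100 <= level_weight m.+1 d.
Proof.
move=> M100 hd; apply: wmask_ge_first => //.
have NR : (0 : R) < (N m.+1)%:R by rewrite ltr0n N0.
have := PR0 m => p0.
rewrite pprodS natrM mulrA normrM normfV (gtr0_norm (mulr_gt0 p0 NR)).
rewrite ler_pdivrMr ?mulr_gt0// normrM normr_nat.
have h : (M m.+1)%:R * `|d| <= (N m.+1)%:R * (14 / 25 * (pprod N m)%:R).
  by apply: ler_pM => //; rewrite ler_nat hMN.
by move: h; congr (_ <= _); ring.
Qed.

(** Since N_(i+1) >= M_(i+1) and N_i >= M_i, the mask of level i + 1 is evaluated at
    a point of size at most 14 / (25 M_(i+1) M_i); the constant 21 bounds
    64 (14/25)^2. *)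
Lemma level_weight_next m i d : (m < i)%N ->
  `|d| <= 14 / 25 * (pprod N m)%:R ->
  1 - level_weight i.+1 d <= 4 * (M i.+1)%:R^-1 + 21 * (M i)%:R^-1.
Proof.
case: i => // i mi hd; rewrite ltnS in mi.
have := @wmask_ge_tail R (M i.+2) (n i.+2) (d / (pprod N i.+2)%:R) (M0 (ltn0Sn _)).
rewrite -/(level_weight _ _) => h.
have M1 := MR0 (ltn0Sn i); have M2 := MR0 (ltn0Sn i.+1).
have N1 : (0 : R) < (N i.+1)%:R by rewrite ltr0n N0.
have N2 : (0 : R) < (N i.+2)%:R by rewrite ltr0n N0.
have p0 := PR0 i.
set y := (M i.+2)%:R * _ in h.
have hy : `|y| <= 14 / 25 * (M i.+1)%:R^-1.
  have hd2 : `|d| <= 14 / 25 * (pprod N i)%:R.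
    by apply: le_trans hd _; rewrite ler_pM2l// ler_nat dvdn_leq ?pprod_gt0 ?pprod_dvd.
  rewrite /y pprodS pprodS !natrM mulrA normrM normfV.
  rewrite (gtr0_norm (mulr_gt0 (mulr_gt0 p0 N1) N2)) ler_pdivrMr ?mulr_gt0//.
  rewrite normrM normr_nat.
  have h1 : (M i.+2)%:R * `|d| <= (N i.+2)%:R * (14 / 25 * (pprod N i)%:R).
    by apply: ler_pM => //; rewrite ler_nat hMN.
  apply: le_trans h1 _.
  have h2 : 1 <= (M i.+1)%:R^-1 * (N i.+1)%:R :> R.
    by rewrite mulrC ler_pdivlMr// mul1r ler_nat hMN.
  have h3 : 0 <= (N i.+2)%:R * (14 / 25 * (pprod N i)%:R) :> R.
    by rewrite !mulr_ge0.
  have := ler_wpM2l h3 h2; rewrite mulr1; congr (_ <= _).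
  by ring.
have Mi1 : (M i.+1)%:R^-1 <= 1 :> R by rewrite invf_le1// ler1n M0.
have M1i : 0 <= (M i.+1)%:R^-1 :> R by rewrite invr_ge0 ltW.
have hy2 : y ^+ 2 <= (14 / 25) ^+ 2 * (M i.+1)%:R^-1.
  rewrite -real_normK ?num_real//.
  have : `|y| ^+ 2 <= (14 / 25 * (M i.+1)%:R^-1) ^+ 2.
    by rewrite ler_sqr ?nnegrE// mulr_ge0.
  move=> /le_trans; apply; rewrite exprMn ler_wpM2l ?sqr_ge0//.
  by rewrite expr2 ler_piMl.
move: h hy2 M1i; move: (y ^+ 2) (M i.+2)%:R^-1 (M i.+1)%:R^-1 => a b c h hy2 c0.
by lra.
Qed.

(** Beyond level m, the mask of level m + 1 is at least 1/100 in square, and the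
    later ones have summable defects of total at most 25/100. *)
Lemma fourier_fin_lower n0 m k d :
  (forall K, \sum_(n0 <= i < K) (M i)%:R^-1 <= 1 / 100 :> R) ->
  (1 <= n0)%N -> (n0 <= m)%N -> (m <= k)%N -> `|d| <= 14 / 25 * (pprod N m)%:R ->
  nsq (fourier_fin m d) <= 200 * nsq (fourier_fin k d).
Proof.
move=> hs n1 n0m mk hd; rewrite (fourier_fin_tail _ mk) mulrCA ler_peMr ?nsq_ge0//.
have Mi0 i : 0 <= (M i)%:R^-1 :> R by rewrite invr_ge0.
have M100 i : (n0 <= i)%N -> (100 <= M i)%N.
  move=> n0i; have := hs i.+1; rewrite big_nat_recr//= => h.
  have h0 : 0 <= \sum_(n0 <= j < i) (M j)%:R^-1 :> R by apply: sumr_ge0.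
  have : (M i)%:R^-1 <= 1 / 100 :> R by lra.
  rewrite div1r lef_pV2 ?posrE// ?ler_nat//; apply: MR0.
  exact: leq_trans n1 n0i.
move: mk; rewrite leq_eqVlt => /orP[/eqP ->|mk].
  by rewrite big_geq// mulr1 ler1n.
rewrite big_ltn ?ltnS//.
have w1 := @level_weight_first m d (M100 _ (leqW n0m)) hd.
have w2 : 1 / 2 <= \prod_(m.+2 <= i < k.+1) level_weight i d.
  rewrite big_nat_cond; apply: le_trans (prod_ge_1_sub_sum _ _); last first.
    move=> i; rewrite andbT => /andP[mi _]; apply: level_weight01.
    exact: leq_trans mi.
  rewrite -big_nat_cond.
  have : \sum_(m.+2 <= i < k.+1) (1 - level_weight i d) <=
     \sum_(m.+2 <= i < k.+1) (4 * (M i)%:R^-1 + 21 * (M i.-1)%:R^-1).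
    rewrite big_nat_cond [leRHS]big_nat_cond; apply: ler_sum => i.
    rewrite andbT => /andP[]; case: i => // i mi _ /=.
    exact: level_weight_next hd.
  move=> /le_trans hle; rewrite lerBrDl -lerBrDr; apply: hle; rewrite big_split /= -!mulr_sumr.
  have s1 : \sum_(m.+2 <= i < k.+1) (M i)%:R^-1 <= 1 / 100 :> R.
    apply: le_trans (hs k.+1).
    have a1 : (n0 <= m.+2)%N by rewrite (leq_trans n0m)// -addn2 leq_addr.
    have a2 : (m.+2 <= k.+1)%N by rewrite ltnS.
    by rewrite [leRHS](big_cat_nat a1 a2)/= lerDr sumr_ge0.
  have s2 : \sum_(m.+2 <= i < k.+1) (M i.-1)%:R^-1 <= 1 / 100 :> R.
    rewrite big_add1 /=; apply: le_trans (hs k).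
    by rewrite [leRHS](big_cat_nat (leqW n0m) mk)/= lerDr sumr_ge0.
  by lra.
by have := ler_pM _ _ w1 w2; nra.
Qed.

End Tails.

(** * Sufficiency *)

Section Sufficiency.
Context {R : realType}.
Local Notation C := R[i].
Variables (N M n : nat -> nat) (phi : R -> C).
Hypothesis hM : forall k, (1 <= k)%N -> (3 <= M k)%N.
Hypothesis hMN : forall k, (1 <= k)%N -> (M k <= N k)%N.
Hypothesis hn : forall k, (1 <= k)%N -> (1 <= n k)%N.
Hypothesis hdiv : forall k, (2 <= k)%N -> (M k %| N k)%N.
Hypothesis phi_lim : forall x, ccvg (fun k => fourier_fin N M n k x) (phi x).
Hypothesis phi0 : phi 0 = 1.
Hypothesis phi_conj : forall x, conjc (phi x) = phi (- x).
Variable n0 : nat.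
Hypothesis n0_gt0 : (1 <= n0)%N.
Hypothesis tail_small : forall K, \sum_(n0 <= i < K) (M i)%:R^-1 <= 1 / 100 :> R.

Local Notation fourier_fin := (@fourier_fin R N M n).
Local Notation level_spectrum := (@level_spectrum R N M).

Definition spectrum : set R := [set x | exists k, x \in level_spectrum k].

Lemma countable_spectrum : countable spectrum.
Proof.
have -> : spectrum = \bigcup_k [set` level_spectrum k].
  by apply/seteqP; split => [x [k xk]|x [k _ xk]]; exists k.
by apply: bigcup_countable => // k _; apply: finite_set_countable; exact: finite_seq.
Qed.

Lemma spectrum_orth : orthogonal_spectrum phi spectrum.
Proof.
move=> x y [k xk] [l yl] xy; apply: (ccvg_unique (phi_lim (x - y))).
apply: (ccvg_eventually (n0 := maxn k l)) (ccvg_cst 0) => m.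
rewrite geq_max => /andP[km lm].
by rewrite (level_spectrum_orth hM hMN hn hdiv (level_spectrum_sub hM km xk) (level_spectrum_sub hM lm yl) xy).
Qed.

Lemma N_large k : (n0 <= k)%N -> (100 <= N k)%N.
Proof.
move=> n0k; have k1 := leq_trans n0_gt0 n0k; apply: leq_trans (hMN k1).
have := tail_small k.+1; rewrite big_nat_recr//= => h.
have h0 : 0 <= \sum_(n0 <= j < k) (M j)%:R^-1 :> R.
  by apply: sumr_ge0 => i _; rewrite invr_ge0.
have : (M k)%:R^-1 <= 1 / 100 :> R by lra.
rewrite div1r lef_pV2 ?posrE// ?ler_nat// ltr0n.
exact: leq_trans (hM k1).
Qed.

Lemma pprod_ge k : (k <= pprod N k)%N.
Proof.
elim: k => // k IH; rewrite pprodS.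
have := leq_trans (hM (ltn0Sn k)) (hMN (ltn0Sn k)).
have : (0 < pprod N k)%N.
  by apply: pprod_gt0 => i i1; exact: leq_trans (leq_trans (hM i1) (hMN i1)).
by nia.
Qed.

(** Level m contributes at most P_m / 2, all previous ones together at most
    3 P_m / 400 since N_m >= 100, and xi at most P_m / 20 when m is large. *)
Lemma dist_level_spectrum_le xi : exists2 m1, (n0 <= m1)%N & forall m x, (m1 <= m)%N ->
  x \in level_spectrum m -> `|xi - x| <= 14 / 25 * (pprod N m)%:R.
Proof.
pose m1 := (n0 + (Num.truncn (20 * `|xi|)).+1)%N.
exists m1 => [|m x]; first exact: leq_addr.
move=> m1m; have n0m : (n0 <= m)%N by apply: leq_trans m1m; exact: leq_addr.
have hxi : 20 * `|xi| <= (pprod N m)%:R.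
  have /truncn_itv/andP[_ /ltW h] : 0 <= 20 * `|xi| by rewrite mulr_ge0.
  apply: le_trans h _; rewrite ler_nat; apply: leq_trans (pprod_ge m).
  by apply: leq_trans m1m; exact: leq_addl.
case: m m1m n0m hxi => [|m] m1m n0m hxi xm.
  by move: n0m; rewrite leqNgt n0_gt0.
have := level_spectrum_le_large hM hMN (N_large n0m) xm.
move: hxi (normr_ge0 xi) (ler_normB xi x); move: (pprod _ _)%:R `|xi| `|x| `|xi - x| => p a b c.
by lra.
Qed.

Lemma spectrum_bessel xi (F : seq R) : uniq F -> {in F, forall x, spectrum x} ->
  \sum_(x <- F) nsq (phi (xi - x)) <= 1.
Proof.
move=> uF FL.
have E x : removed_mask N M n pred0 0 x = 1 by rewrite /removed_mask big_pred0.
have := @bessel_removed R N M n phi hM phi_lim phi0 phi_conj pred0 0 xi F _ uF.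
under eq_bigr do rewrite E divr1.
apply => //; first by move=> x y _ _; rewrite E oner_eq0.
by move=> x y xF yF xy; apply: spectrum_orth => //; exact: FL.
Qed.

(** Dominated convergence for sums over the increasing finite spectra, whose partial
    sums T are bounded by Bessel's inequality. The finite transform of level k is
    dominated on its spectrum by 200 times the limit, so beyond some level m the
    points outside the m-th spectrum contribute at most 200 (T k - T m) to the sum
    1 of level k; the contribution of the m-th spectrum tends to T m. *)
Lemma spectrum_parseval xi : parseval_at phi spectrum xi.
Proof.
move=> eps e0.
have spL k : {in level_spectrum k, forall x, spectrum x} by move=> x xk; exists k.
pose T k := \sum_(x <- level_spectrum k) nsq (phi (xi - x)).
have uS k := level_spectrum_uniq hM hMN hn hdiv k.
have T1 k : T k <= 1 by apply: spectrum_bessel; [exact: uS | exact: spL].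
have [m1 n0m1 hm1] := dist_level_spectrum_le xi.
have split_sum k m (f : R -> R) : (m <= k)%N -> \sum_(x <- level_spectrum k) f x =
    \sum_(x <- level_spectrum m) f x + \sum_(x <- level_spectrum k | x \notin level_spectrum m) f x.
  move=> mk; rewrite (bigID (mem (level_spectrum m)))/=; congr (_ + _).
  rewrite -big_filter; apply: perm_big; apply: uniq_perm; rewrite ?filter_uniq//.
  by move=> x; rewrite mem_filter andb_idr//; exact: level_spectrum_sub.
have Tmono m k : (m <= k)%N -> T m <= T k.
  by move=> mk; rewrite /T (split_sum _ _ _ mk) lerDl sumr_ge0// => x _; exact: nsq_ge0.
have [m m1m hm] : exists2 m, (m1 <= m)%N & forall k, (m <= k)%N -> T k - T m <= eps / 400.
  have sT : has_sup (range T).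
    by split; [exists (T 0%N), 0%N | exists 1 => _ [k _ <-]].
  have [|_ [m _ <-] hm] := @sup_adherent R (range T) (eps / 400) _ sT.
    by lra.
  exists (maxn m m1) => [|k mk]; first exact: leq_maxr.
  have h1 : T k <= sup (range T) by apply: ub_le_sup; [exact: sT.2 | exists k].
  have := Tmono m (maxn m m1) (leq_maxl _ _); lra.
exists (level_spectrum m); split; [exact: uS | exact: spL | ].
suff : 1 - eps / 2 <= T m by rewrite -/(T m); lra.
have cv : \sum_(x <- level_spectrum m) nsq (fourier_fin k (xi - x)) @[k --> \oo] --> T m.
  by apply: cvg_big => [|x _]; [exact: add_continuous | exact: ccvg_nsq].
apply: (cvgr_to_ge cv); exists m => // k /= mk.
have := sum_level_spectrum hM hMN hn hdiv k xi; rewrite (split_sum _ _ _ mk) => hk.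
suff : \sum_(x <- level_spectrum k | x \notin level_spectrum m) nsq (fourier_fin k (xi - x)) <= eps / 2.
  by move: hk; lra.
apply: le_trans (_ : 200 * (T k - T m) <= _); last by have := hm k mk; lra.
rewrite /T (split_sum _ _ _ mk) addrAC subrr add0r mulr_sumr.
rewrite big_seq_cond [leRHS]big_seq_cond; apply: ler_sum => x /andP[xk _].
have hd := hm1 k x (leq_trans m1m mk) xk.
have n0k := leq_trans n0m1 (leq_trans m1m mk).
apply: (cvgr_to_ge (cvgM (cvg_cst (200 : R)) (ccvg_nsq (phi_lim (xi - x))))).
exists k => // l /= kl.
exact: (fourier_fin_lower hM hMN hn tail_small n0_gt0 n0k kl hd).
Qed.

End Sufficiency.

Lemma summable_tail_small {R : realType} (M : nat -> nat) :
  (\sum_(1 <= k <oo) (((M k)%:R : R)^-1)%R%:E < +oo)%E ->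
  exists2 n0, (1 <= n0)%N & forall K, \sum_(n0 <= i < K) (M i)%:R^-1 <= 1 / 100 :> R.
Proof.
move=> hsum.
pose f (k : nat) : \bar R := ((M k)%:R^-1 : R)%:E.
have f0 k : (0 <= f k)%E by rewrite lee_fin invr_ge0.
have s0 : (\sum_(0 <= k <oo | xpredT k) f k < +oo)%E.
  rewrite (@nneseries_split _ _ 0 1)// big_nat1 add0n.
  by apply: lte_add_pinfty; [exact: ltry | exact: hsum].
have cv := nneseries_tail_cvg s0 (fun k _ => f0 k).
have [cf cr] := (fine_cvgP _ _).1 cv.
have h0 : (0 : R) < 1 / 100 by lra.
have [p _ hp] : \forall p \near \oo, (\sum_(p <= k <oo | xpredT k) f k < (1 / 100)%:E)%E.
  near=> p; have pf : (\sum_(p <= k <oo | xpredT k) f k)%E \is a fin_num by near: p.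
  by rewrite -(fineK pf) lte_fin; near: p; exact: (cvgr_lt _ cr).
exists p.+1 => // K; rewrite -lee_fin -sumEFin.
apply: le_trans (ltW (hp p.+1 (leqnSn p))).
by apply: nneseries_lim_ge => k _ _; exact: f0.
Unshelve. all: by end_near.
Qed.

Theorem theorem6p4 (R : realType) (N M n : nat -> nat)
  (hM : forall k, (1 <= k)%N -> (3 <= M k)%N)
  (hN : forall k, (1 <= k)%N -> (M k <= N k)%N)
  (hn : forall k, (1 <= k)%N -> (1 <= n k)%N)
  (hsum : (\sum_(1 <= k <oo) (((M k)%:R : R)^-1)%R%:E < +oo)%E)
  (hgcd : forall k, (1 <= k)%N -> ~~ odd (M k) -> (5 <= M k)%N ->
    gcdn (n k * M k - 1) (M k - 2) = 1%N)
  (mu : probability (measurableTypeR R) R)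
  (hmu : is_infinite_convolution N (fun k => digit_set (M k) (n k)) mu) :
  spectral_measure mu <-> (forall k, (2 <= k)%N -> (M k %| N k)%N).
Proof.
have N0 k : (1 <= k)%N -> (0 < N k)%N.
  by move=> k1; exact: leq_trans (leq_trans (hM k k1) (hN k k1)).
have lim := fourier_fin_cvg hM N0 hn hmu.
split=> [sp [|[|k]] // _|hdiv]; first exact: (spectral_divides hM N0 hn hgcd hmu _ sp).
have [n0 n0_gt0 tail] := summable_tail_small hsum.
apply/spectral_parseval; exists (spectrum N M); split.
- exact: countable_spectrum.
- exact: (spectrum_orth hM hN hn hdiv lim).
- exact: (spectrum_parseval hM hN hn hdiv lim (fourier0 mu) (fourier_conj mu) n0_gt0 tail).
Qed.
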